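(* Let $B\subset A$ be an inclusion of simple unital $C^*$-algebras with a conditional expectation of index-finite type. Then, for each $n\ge 0$, the following hold. (i) The reflection operator $r^{+}_{2n+1}: B'\cap A_{2n+1}\to B'\cap A_{2n+1}$ is a unital, involutive, $*$-preserving anti-homomorphism, and it preserves the trace $\mathrm{tr}$. (ii) The reflection operator $r^{-}_{2n+1}: A'\cap A_{2n+2}\to A'\cap A_{2n+2}$ is a unital, involutive, $*$-preserving anti-homomorphism, and it preserves the trace $\mathrm{tr}$.
   Context: Setting. $B\subset A$ is an inclusion of simple unital $C^*$-algebras (common unit) admitting a conditional expectation of index-finite type. A conditional expectation $E:A\to B$ is of index-finite type if it has a quasi-basis, i.e. a finite set $\{\lambda_1,\dots,\lambda_m\}\subset A$ with $x=\sum_i\lambda_iE(\lambda_i^*x)=\sum_iE(x\lambda_i)\lambda_i^*$ for all $x\in A$; its Watatani index is $\sum_i\lambda_i\lambda_i^*$ (a positive scalar here). $E_0:A\to B$ is the minimal conditional expectation (the unique one of smallest index), $[A:B]_0$ is its index, $\tau=[A:B]_0^{-1}$. Put $A_{-1}=B$, $A_0=A$; for $n\ge1$, $A_n$ is the $C^*$-basic construction of $A_{n-2}\subset A_{n-1}$ with respect to $E_{n-1}$, with Jones projection $e_n\in A_n$ (so $e_nxe_n=E_{n-1}(x)e_n$ for $x\in A_{n-1}$ and $A_n=\mathrm{span}\,A_{n-1}e_nA_{n-1}$), and $E_n:A_n\to A_{n-1}$ is the dual (minimal) conditional expectation, $E_n(xe_ny)=\tau xy$ for $x,y\in A_{n-1}$.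 For $C\subset D$, $C'\cap D=\{d\in D: dc=cd\ \forall c\in C\}$; the relative commutants $B'\cap A_n$ are finite-dimensional. $\mathrm{tr}$ is the faithful tracial state on $B'\cap A_n$ given by the restriction of $E_0\circ E_1\circ\cdots\circ E_n$; these are compatible for varying $n$ and are restricted to the subalgebras $A'\cap A_n$. Fourier transform. $v_n=e_ne_{n-1}\cdots e_1$. $E^{B'\cap A_n}_{A'\cap A_n}$ is the $\mathrm{tr}$-preserving conditional expectation; $E^{B'\cap A_n}_{A'\cap A_n}(x)=\tau\sum_i\lambda_ix\lambda_i^*$ for any quasi-basis $\{\lambda_i\}$ of $E_0$. For $n\ge0$, $\mathcal F_n:B'\cap A_n\to A'\cap A_{n+1}$, $\mathcal F_n(x)=\tau^{-\frac{n+2}{2}}E^{B'\cap A_{n+1}}_{A'\cap A_{n+1}}(xv_{n+1})$, a bijection with inverse $\mathcal F_n^{-1}(w)=\tau^{-\frac{n+2}{2}}E_{n+1}(wv_{n+1}^* )$. Rotations. $\rho_n^+:B'\cap A_n\to B'\cap A_n$, $\rho_n^+(x)=\big(\mathcal F_n^{-1}(\mathcal F_n(x)^* )\big)^*$, and $\rho_n^-:A'\cap A_{n+1}\to A'\cap A_{n+1}$, $\rho_n^-(w)=\big(\mathcal F_n(\mathcal F_n^{-1}(w)^* )\big)^*$. Reflections. For $n\ge0$, $r^+_{2n+1}=(\rho^+_{2n+1})^{n+1}$ on $B'\cap A_{2n+1}$ and $r^-_{2n+1}=(\rho^-_{2n+1})^{n+1}$ on $A'\cap A_{2n+2}$ (powers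 under composition). *)

(* Defs.v *)
From HB Require Import structures.
From mathcomp Require Import all_boot all_order all_algebra.
From mathcomp Require Import complex.
From mathcomp Require Import classical_sets reals exp.

Set Implicit Arguments.
Unset Strict Implicit.
Unset Printing Implicit Defensive.

Import Order.TTheory GRing.Theory Num.Theory.

Local Open Scope classical_set_scope.
Local Open Scope ring_scope.
Local Open Scope complex_scope.

(* Unital complex C*-algebras.  The library's normed modules cannot be joined
   with its algebras in one structure (the join with numDomainType is missing),
   hence the explicit R-valued norm. *)
HB.mixin Record isCStar (R : realType) M of GRing.Algebra R[i] M := {
  star : M -> M;
  cnorm : M -> R;
  starD : forall x y : M, star (x + y) = star x + star y;
  starZ : forall (a : R[i]) (x : M), star (a *: x) = Num.conj a *: star x;
  starM : forall x y : M, star (x * y) = star y * star x;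
  starK : forall x : M, star (star x) = x;
  cnorm_eq0 : forall x : M, cnorm x = 0 -> x = 0;
  cnormD_le : forall x y : M, cnorm (x + y) <= cnorm x + cnorm y;
  cnormZ : forall (a : R[i]) (x : M),
    (cnorm (a *: x))%:C = `|a| * (cnorm x)%:C;
  cnormM_le : forall x y : M, cnorm (x * y) <= cnorm x * cnorm y;
  cnorm_star : forall x : M, cnorm (star x * x) = cnorm x ^+ 2;
  cnorm_complete : forall u : nat -> M,
    (forall eps : R, 0 < eps -> exists N : nat, forall m n : nat,
       (N <= m)%N -> (N <= n)%N -> cnorm (u m - u n) < eps) ->
    exists l : M, forall eps : R, 0 < eps -> exists N : nat, forall n : nat,
      (N <= n)%N -> cnorm (u n - l) < eps;
}.

#[short(type="cstarType")]
HB.structure Definition CStar (R : realType) :=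
  {M of isCStar R M & GRing.Algebra R[i] M}.

Section CStarNotions.
Variables (R : realType) (M : cstarType R).
Implicit Types (A B D I S : set M) (E T : M -> M) (s : seq M).

Definition norm_closed S : Prop :=
  forall x, (forall eps : R, 0 < eps -> exists2 y, S y & cnorm (x - y) < eps) ->
    S x.

Record cstar_subalg S : Prop := CStarSubalg {
  subalg1 : S 1;
  subalgL : forall (a : R[i]) x y, S x -> S y -> S (a *: x + y);
  subalgM : forall x y, S x -> S y -> S (x * y);
  subalg_star : forall x, S x -> S (star x);
  subalg_closed : norm_closed S }.

Record closed_ideal S I : Prop := ClosedIdeal {
  ideal_sub : I `<=` S;
  ideal0 : I 0;
  idealL : forall (a : R[i]) x y, I x -> I y -> I (a *: x + y);
  idealMl : forall c x, S c -> I x -> I (c * x);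
  idealMr : forall x c, I x -> S c -> I (x * c);
  ideal_closed : norm_closed I }.

Definition simple_cstar S : Prop :=
  forall I, closed_ideal S I -> I = [set 0] \/ I = S.

(* C' `&` D *)
Definition relcomm (C D : set M) : set M :=
  [set d | D d /\ forall c, C c -> d * c = c * d].

(* Maps between subalgebras are total functions M -> M of which only the
   restriction to the source subalgebra matters. *)
Record cond_exp A B E : Prop := CondExp {
  cexp_in : forall x, A x -> B (E x);
  cexpL : forall (a : R[i]) x y, A x -> A y -> E (a *: x + y) = a *: E x + E y;
  cexp_id : forall b, B b -> E b = b;
  cexpM : forall b x c, B b -> A x -> B c -> E (b * x * c) = b * E x * c;
  cexp_ge0 : forall x, A x -> exists2 y, B y & E (star x * x) = star y * y }.

Definition quasi_basis A E s : Prop :=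
  {in s, forall l, A l} /\
  forall x, A x ->
    x = \sum_(l <- s) l * E (star l * x) /\
    x = \sum_(l <- s) E (x * l) * star l.

(* E is a conditional expectation of index-finite type with Watatani index the
   scalar c; for simple algebras every Watatani index is a scalar, and it does
   not depend on the quasi-basis. *)
Definition has_index A B E (c : R) : Prop :=
  cond_exp A B E /\
  exists2 s, quasi_basis A E s & \sum_(l <- s) l * star l = c%:C *: 1.

Definition minimal_cond_exp A B E (c : R) : Prop :=
  has_index A B E c /\ forall E' c', has_index A B E' c' -> c <= c'.

(* T and T' are mutually adjoint operators on the right Hilbert B-module A
   whose B-valued inner product is <x, y> = E (star x * y). *)
Definition adjoint_ops A E T T' : Prop :=
  forall x y, A x -> A y ->
    [/\ A (T y), A (T' x) & E (star (T' x) * y) = E (star x * T y)].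

(* pi is an isomorphism from D onto the algebra of adjointable operators
   spanned by the operators lambda(a) E lambda(b), where a, b range over A and
   lambda(a) is left multiplication by a; it restricts to lambda on A and maps
   e to the Jones projection, i.e. to E itself seen as an operator on A.  (An
   injective *-homomorphism between C*-algebras is isometric, and the span is
   complete when E is of index-finite type.) *)
Record basic_construction_iso A E D (e : M) (pi : M -> M -> M) : Prop := {
  bc_linear : forall (a : R[i]) d d' x, D d -> D d' -> A x ->
    pi (a *: d + d') x = a *: pi d x + pi d' x;
  bc_mul : forall d d' x, D d -> D d' -> A x -> pi (d * d') x = pi d (pi d' x);
  bc_star : forall d, D d -> adjoint_ops A E (pi d) (pi (star d));
  bc_inj : forall d, D d -> (forall x, A x -> pi d x = 0) -> d = 0;
  bc_lambda : forall a x, A a -> A x -> pi a x = a * x;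
  bc_jones : forall x, A x -> pi e x = E x }.

(* D is the C*-basic construction of B `<=` A with respect to E : A -> B, with
   Jones projection e. *)
Definition basic_construction A E D (e : M) : Prop :=
  [/\ A `<=` D, D e,
      D = [set d | exists2 s : seq (M * M), {in s, forall p, A p.1 /\ A p.2}
                   & d = \sum_(p <- s) p.1 * e * p.2]
    & exists pi, basic_construction_iso A E D e pi].

End CStarNotions.

(* The tower B `<=` A = A_0 `<=` A_1 `<=` ... of an inclusion of simple unital
   C*-algebras.  All its terms are C*-subalgebras, with the same unit, of one
   C*-algebra M, for instance of the inductive limit of the tower.
   jt_A n, jt_E n and jt_e n stand for A_n, E_n and e_n; jt_e 0 is unused. *)
Record jonesTower (R : realType) (M : cstarType R) := JonesTower {
  jt_B : set M;
  jt_A : nat -> set M;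
  jt_E : nat -> M -> M;
  jt_e : nat -> M;
  jt_index : R;
  (* A_(n-1), with A_(-1) = B *)
  jt_pred n := if n is m.+1 then jt_A m else jt_B;
  jt_subalgB : cstar_subalg jt_B;
  jt_subalgA : forall n, cstar_subalg (jt_A n);
  jt_sub : jt_B `<=` jt_A 0;
  jt_simpleB : simple_cstar jt_B;
  jt_simpleA : simple_cstar (jt_A 0);
  jt_minimal : minimal_cond_exp (jt_A 0) jt_B (jt_E 0) jt_index;
  jt_index_gt0 : 0 < jt_index;
  jt_basic : forall n,
    basic_construction (jt_A n) (jt_E n) (jt_A n.+1) (jt_e n.+1);
  jt_cond_exp : forall n, cond_exp (jt_A n) (jt_pred n) (jt_E n);
  jt_dual : forall n x y, jt_A n x -> jt_A n y ->
    jt_E n.+1 (x * jt_e n.+1 * y) = (jt_index^-1)%:C *: (x * y) }.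

Section Rotations.
Variables (R : realType) (M : cstarType R) (T : jonesTower M).

Let A := jt_A T.
Let B := jt_B T.
Let E := jt_E T.

Definition BcommA n : set M := relcomm B (A n).
Definition AcommA n : set M := relcomm (A 0) (A n).

(* E_0 \o E_1 \o ... \o E_n; on BcommA n its values are in relcomm B B, that is
   in C 1, and it is the scalar tr x multiplied by 1. *)
Fixpoint tr n : M -> M := if n is m.+1 then tr m \o E m.+1 else E 0.

(* G is the tr-preserving conditional expectation from BcommA n onto
   AcommA n. *)
Definition tr_cond_exp n (G : M -> M) : Prop :=
  cond_exp (BcommA n) (AcommA n) G /\
  forall x, BcommA n x -> tr n (G x) = tr n x.

(* e_n e_(n-1) ... e_1 *)
Fixpoint vtower n : M := if n is m.+1 then jt_e T n * vtower m else 1.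

(* tau^(-(n+2)/2), where tau is the inverse of the index *)
Definition fourier_cst n : R[i] :=
  (((jt_index T)^-1) `^ (- (n.+2%:R / 2)))%:C.

(* G n : the tr-preserving conditional expectation BcommA n -> AcommA n *)
Variable G : nat -> M -> M.

Definition fourier n (x : M) : M :=
  fourier_cst n *: G n.+1 (x * vtower n.+1).

Definition fourier_inv n (w : M) : M :=
  fourier_cst n *: E n.+1 (w * star (vtower n.+1)).

Definition rho_plus n (x : M) : M :=
  star (fourier_inv n (star (fourier n x))).

Definition rho_minus n (w : M) : M :=
  star (fourier n (star (fourier_inv n w))).

(* r^+_(2n+1) and r^-_(2n+1) *)
Definition r_plus n : M -> M := iter n.+1 (rho_plus n.*2.+1).
Definition r_minus n : M -> M := iter n.+1 (rho_minus n.*2.+1).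

End Rotations.

(* r is a unital involutive *-preserving anti-homomorphism S -> S of complex
   algebras which preserves t. *)
Record reflection_on (R : realType) (M : cstarType R) (S : set M)
    (t r : M -> M) : Prop := ReflectionOn {
  refl_in : forall x, S x -> S (r x);
  refl_linear : forall (a : R[i]) x y, S x -> S y ->
    r (a *: x + y) = a *: r x + r y;
  refl_antiM : forall x y, S x -> S y -> r (x * y) = r y * r x;
  refl1 : r 1 = 1;
  reflK : forall x, S x -> r (r x) = x;
  refl_star : forall x, S x -> r (star x) = star (r x);
  refl_tr : forall x, S x -> t (r x) = t x }.

(* Main.v *)
(* Let [f] be the multiple of the Jones projection of B <= A_n given by the
   (n+1) x (n+1) array of staggered Jones projections.  Since
   [A_(2n+1) f = A_n f] and [f A_(2n+1) = f A_n], the elements of A_(2n+1) act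
   on A_n from both sides, by [y b f = a f] and by [f b x = f a].  The Fourier
   transform satisfies [F(x) e_1 ... e_k = x e_k], and iterating this exhibits [x]
   and its rotation by n+1 clicks as partial traces of [w f f'] and [f' f w] for
   one and the same [w] commuting with A_n.  It follows that the left action of
   [r^+(x)] is the right action of [x], that is, its transpose for the bilinear
   form [E(ab)], where E is the composite of the E_i.  Transposition is
   anti-multiplicative, and it is involutive and compatible with the adjoint
   because [E(xz) = E(zx)] for all [x] commuting with B and all [z].

   This traciality is where minimality enters.  The perturbed expectations
   [E(k . k)] with [k = 1 - d h] have an index whose derivative at [d = 0] must
   vanish, so that [sum lambda h lambda^* = c E(h)] on the relative commutant.
   This makes the modular automorphism of the relative commutant an involution,
   and a positivity argument then shows that it is the identity.

   For r^-, rho^- is the inverse of the rotation rho^+ of the tower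
   A <= A_1 <= ..., whose (n+1)-st power is an involution. *)

(* Simplicity is known only for [B] and [A], and minimality only for [E_0]. Each enters through one
   consequence, scalar centres and the index identity on the relative commutant, and both
   consequences climb the tower because a Jones projection pushes every element of an algebra down
   to the preceding one. Scalar centres turn the expectations of relative commutants into numbers;
   they come from norm estimates on Cesaro means, without spectral theory. The rotations are treated
   for the towers starting at all levels at once: the Fourier transform intertwines the rotation of
   one tower with that of the next, so clicks can be iterated, and r^- becomes a half turn of the
   tower that starts at [A]. Preservation of the trace is proved separately, by cancelling [f]
   inside both partial traces. *)
Require Import Defs.
From mathcomp Require Import all_boot all_order all_algebra.
From mathcomp Require Import classical_sets reals.
From mathcomp Require Import complex exp ring lra zify.

Set Implicit Arguments.
Unset Strict Implicit.
Unset Printing Implicit Defensive.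

Import Order.TTheory GRing.Theory Num.Theory.

Local Open Scope classical_set_scope.
Local Open Scope ring_scope.
Local Open Scope complex_scope.

(** * Norms and centres of C*-algebras *)

Section Star.
Variables (R : realType) (M : cstarType R).
Implicit Types (x y z : M) (a : R[i]).

Lemma star0 : star 0 = 0 :> M.
Proof. by apply: (addrI (star 0)); rewrite -starD !addr0. Qed.

Lemma starN x : star (- x) = - star x.
Proof. by apply: (addrI (star x)); rewrite -starD !subrr star0. Qed.

Lemma starB x y : star (x - y) = star x - star y.
Proof. by rewrite starD starN. Qed.

Lemma star1 : star 1 = 1 :> M.
Proof. by rewrite -[LHS]mulr1 -{2}(starK (1 : M)) -starM mulr1 starK. Qed.

Lemma star_sum I (r : seq I) (F : I -> M) :
  star (\sum_(i <- r) F i) = \sum_(i <- r) star (F i).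
Proof. exact: (big_morph _ starD star0). Qed.

Lemma starZr (t : R) x : star (t%:C *: x) = t%:C *: star x.
Proof. by rewrite starZ; congr (_ *: _); apply: conj_Creal; rewrite complex_real. Qed.

Lemma cnorm0 : cnorm (0 : M) = 0.
Proof.
have := cnormZ 0 (0 : M); rewrite scale0r normr0 mul0r.
by move=> h; apply: (@complexI R); rewrite h rmorph0.
Qed.

Lemma cnormZr (t : R) x : cnorm (t%:C *: x) = `|t| * cnorm x.
Proof.
have := cnormZ t%:C x; rewrite normc_def /= expr0n addr0 sqrtr_sqr.
by rewrite -rmorphM => /complexI.
Qed.

Lemma cnormN x : cnorm (- x) = cnorm x.
Proof.
by have := cnormZr (-1) x; rewrite normrN1 mul1r rmorphN rmorph1 scaleN1r.
Qed.

Lemma cnorm_ge0 x : 0 <= cnorm x.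
Proof.
have := cnormD_le x (- x); rewrite subrr cnorm0 cnormN; lra.
Qed.

Lemma cnorm_distC x y : cnorm (x - y) = cnorm (y - x).
Proof. by rewrite -cnormN opprB. Qed.

Lemma cnormB_le x y : cnorm (x - y) <= cnorm x + cnorm y.
Proof. by rewrite -[cnorm y]cnormN cnormD_le. Qed.

Lemma cnorm_le_dist x y : cnorm x <= cnorm y + cnorm (x - y).
Proof. by apply: le_trans (cnormD_le _ _); rewrite addrC subrK. Qed.

Lemma cnorm_eq0P x : (cnorm x == 0) = (x == 0).
Proof.
by apply/eqP/eqP => [/cnorm_eq0|->] //; rewrite cnorm0.
Qed.

Lemma cnorm_gt0 x : x != 0 -> 0 < cnorm x.
Proof. by rewrite -cnorm_eq0P lt_def cnorm_ge0 andbT. Qed.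

Lemma cnorm_self x : star x = x -> cnorm (x ^+ 2) = cnorm x ^+ 2.
Proof. by move=> sx; rewrite -cnorm_star sx. Qed.

Lemma cnorm1 : cnorm (1 : M) = 1.
Proof.
have /eqP := cnorm_self star1; rewrite expr1n expr2.
rewrite -subr_eq0 -{1}[cnorm 1]mulr1 -mulrBr mulf_eq0 subr_eq0 cnorm_eq0P oner_eq0 /=.
by move/eqP.
Qed.

Lemma star_mul_eq0 x : star x * x = 0 -> x = 0.
Proof.
move=> h; apply: cnorm_eq0; have := cnorm_star x; rewrite h cnorm0.
by move/esym/eqP; rewrite expf_eq0 /= => /eqP.
Qed.

Lemma starX x n : star (x ^+ n) = star x ^+ n.
Proof. by elim: n => [|n ih]; rewrite ?star1 // exprS starM ih -exprSr. Qed.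

Lemma cnormX_le x n : cnorm (x ^+ n) <= cnorm x ^+ n.
Proof.
elim: n => [|n ih]; first by rewrite !expr0 cnorm1.
rewrite !exprS; apply: le_trans (cnormM_le _ _) _.
by rewrite ler_wpM2l ?cnorm_ge0.
Qed.

Lemma cnorm_sum I (r : seq I) (F : I -> M) :
  cnorm (\sum_(i <- r) F i) <= \sum_(i <- r) cnorm (F i).
Proof.
elim/big_rec2: _ => [|i y x _ le]; first by rewrite cnorm0.
by apply: le_trans (cnormD_le _ _) _; rewrite lerD2l.
Qed.

Lemma scale1_inj a b : a *: (1 : M) = b *: 1 -> a = b.
Proof.
move/eqP; rewrite -subr_eq0 -scalerBl => /eqP h.
have := cnormZ (a - b) (1 : M); rewrite h cnorm0 cnorm1 rmorph1 mulr1 rmorph0.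
by move/esym/eqP; rewrite normr_eq0 subr_eq0 => /eqP.
Qed.

Lemma cnorm_scale1 (t : R) : cnorm (t%:C *: (1 : M)) = `|t|.
Proof. by rewrite cnormZr cnorm1 mulr1. Qed.

Lemma self_scale1 a : star (a *: (1 : M)) = a *: 1 -> exists t : R, a = t%:C.
Proof.
by rewrite starZ star1 => /scale1_inj h; apply/complex_realP/CrealP.
Qed.

End Star.

Section Subalgebra.
Variables (R : realType) (M : cstarType R) (S : set M).
Hypothesis subS : cstar_subalg S.
Implicit Types (x y : M).

Lemma sub0 : S 0.
Proof. by have := subalgL subS (-1) (subalg1 subS) (subalg1 subS); rewrite scaleN1r addNr. Qed.

Lemma subZ a x : S x -> S (a *: x).
Proof. by move=> Sx; have := subalgL subS a Sx sub0; rewrite addr0. Qed.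

Lemma subD x y : S x -> S y -> S (x + y).
Proof. by move=> Sx Sy; have := subalgL subS 1 Sx Sy; rewrite scale1r. Qed.

Lemma subN x : S x -> S (- x).
Proof. by move=> Sx; have := subZ (-1) Sx; rewrite scaleN1r. Qed.

Lemma subB x y : S x -> S y -> S (x - y).
Proof. by move=> Sx Sy; apply: subD => //; apply: subN. Qed.

Lemma subX x n : S x -> S (x ^+ n).
Proof.
move=> Sx; elim: n => [|n ih]; first by rewrite expr0; apply: subalg1.
by rewrite exprS; apply: subalgM.
Qed.

Lemma sub_sum (I : eqType) (r : seq I) (F : I -> M) :
  {in r, forall i, S (F i)} -> S (\sum_(i <- r) F i).
Proof.
move=> h; rewrite big_seq; elim/big_rec: _ => [|i x ri Sx]; first exact: sub0.
by apply: subD => //; apply: h.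
Qed.

End Subalgebra.

(** * Limits and the Neumann series *)

Section Small.
Variable R : realType.

Definition small (f : nat -> R) :=
  forall eps : R, 0 < eps -> exists N : nat, forall p : nat, (N <= p)%N -> f p < eps.

Lemma small_le f g (K : R) : 0 <= K -> (forall p : nat, f p <= K * g p) ->
  small g -> small f.
Proof.
move=> K0 fg sg eps e0.
have K1 : 0 < K + 1 by lra.
have [N hN] := sg _ (divr_gt0 e0 K1); exists N => p Np.
apply: le_lt_trans (fg p) _; have := hN p Np; rewrite ltr_pdivlMr // => h.
have [g0|g0] := leP 0 (g p); first by nra.
by nra.
Qed.

Lemma smallD f g : small f -> small g -> small (fun p => f p + g p).
Proof.
move=> sf sg eps e0.
have e2 : 0 < eps / 2 by lra.
have [N hN] := sf _ e2; have [N' hN'] := sg _ e2; exists (N + N')%N => p Np.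
have := hN p (leq_trans (leq_addr _ _) Np).
by have := hN' p (leq_trans (leq_addl _ _) Np); lra.
Qed.

End Small.

Section Limits.
Variables (R : realType) (M : cstarType R).
Implicit Types (x y z : M).

Lemma exp_half_small (eps : R) : 0 < eps -> exists N, (2^-1 : R) ^+ N < eps.
Proof.
move=> e0; exists (Num.Def.archi_bound eps^-1).
have := upper_nthrootP (leqnn (Num.Def.archi_bound eps^-1)) => h.
by rewrite exprVn invf_plt // ?posrE // exprn_gt0.
Qed.

Lemma eq0_small x : (forall eps : R, 0 < eps -> cnorm x <= eps) -> x = 0.
Proof.
move=> h; apply: cnorm_eq0; apply/eqP; rewrite eq_le cnorm_ge0 andbT.
by apply/ler_addgt0Pr => e e0; rewrite add0r h.
Qed.

(** Inverts the perturbation [1 - d h] inside the subalgebra; the bound 2 on the inverse feeds the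
    second-order error term of [perturbed_index]. *)
Lemma neumann S y : cstar_subalg S -> S y -> cnorm y <= 2^-1 ->
  exists g, [/\ S g, g * (1 - y) = 1, (1 - y) * g = 1 & cnorm g <= 2].
Proof.
move=> subS Sy yle.
pose u n : M := \sum_(i < n) y ^+ i.
have Su n : S (u n).
  by apply: sub_sum => // i _; apply: subX.
have yX n : cnorm (y ^+ n) <= 2^-1 ^+ n.
  apply: le_trans (cnormX_le _ _) _.
  by rewrite lerXn2r // nnegrE ?cnorm_ge0 // invr_ge0.
have uB n m : (n <= m)%N -> cnorm (u m - u n) <= 2 * 2^-1 ^+ n - 2 * 2^-1 ^+ m.
  move=> /subnKC <-; elim: (m - n)%N => [|k ih].
    by rewrite addn0 !subrr cnorm0.
  rewrite addnS /u big_ord_recr /= -/(u _) -addrA [_ - u n]addrC addrA.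
  apply: le_trans (cnormD_le _ _) _.
  by have := yX (n + k)%N; rewrite exprS; move: ih; lra.
have half_ge0 n : 0 <= (2^-1 : R) ^+ n by rewrite exprn_ge0 // invr_ge0.
have [|l hl] := @cnorm_complete R M u.
  move=> eps e0; have [N hN] := exp_half_small (divr_gt0 e0 (ltr0n _ 4)).
  exists N => m n Nm Nn.
  have := cnorm_le_dist (u m - u n) (u m - u N).
  rewrite opprB [X in _ + cnorm X]addrC subrKA [cnorm (u N - _)]cnorm_distC.
  have := uB _ _ Nm; have := uB _ _ Nn; have := half_ge0 m; have := half_ge0 n.
  by move: hN; lra.
have uE n : (1 - y) * u n = 1 - y ^+ n.
  by rewrite -opprB -[in RHS]opprB mulNr -subrX1.
have comm_u n : y * u n = u n * y.
  by apply: commr_sum => i _; apply: commrX.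
have key (c : M) : (forall n, cnorm (c - (1 - y ^+ n)) <= 2 * cnorm (u n - l)) -> c = 1.
  move=> hc; apply/eqP; rewrite -subr_eq0; apply/eqP/eq0_small => eps e0.
  have [N hN] := exp_half_small (divr_gt0 e0 (ltr0n _ 4)).
  have [N' hN'] := hl _ (divr_gt0 e0 (ltr0n _ 8)).
  have := hc (N + N')%N; have := hN' (N + N')%N (leq_addl _ _).
  have := yX (N + N')%N.
  have : (2^-1 : R) ^+ (N + N') <= 2^-1 ^+ N.
    by rewrite exprD ler_piMr // exprn_ile1 // ?invr_ge0 // invf_le1 // ler1n.
  have := cnorm_le_dist (c - 1) (c - (1 - y ^+ (N + N'))).
  have -> : c - 1 - (c - (1 - y ^+ (N + N'))) = - y ^+ (N + N').
    by rewrite opprB addrC subrKA addrAC subrr add0r.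
  by rewrite cnormN; move: hN; lra.
have y1 : cnorm (1 - y) <= 2.
  by have := cnormB_le 1 y; rewrite cnorm1; move: yle; lra.
have gl : (1 - y) * l = 1.
  apply: key => n; rewrite -uE -mulrBr [cnorm (u n - l)]cnorm_distC.
  by apply: le_trans (cnormM_le _ _) _; rewrite ler_wpM2r ?cnorm_ge0.
have gr : l * (1 - y) = 1.
  apply: key => n.
  have -> : 1 - y ^+ n = u n * (1 - y) by rewrite mulrBr mulr1 -comm_u -uE mulrBl mul1r.
  rewrite -mulrBl [cnorm (u n - l)]cnorm_distC mulrC.
  by apply: le_trans (cnormM_le _ _) _; rewrite ler_wpM2l ?cnorm_ge0.
exists l; split=> //.
  apply: (Defs.subalg_closed subS) => eps e0; have [N hN] := hl _ e0.
  by exists (u N) => //; rewrite cnorm_distC hN.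
have e : l - 1 = y * l by rewrite -{1}gl mulrBl mul1r opprB addrC subrK.
have := cnorm_le_dist l 1; rewrite cnorm1 e; have := cnormM_le y l.
have : cnorm y * cnorm l <= 2^-1 * cnorm l by rewrite ler_wpM2r // cnorm_ge0.
by lra.
Qed.

End Limits.

(** * Centres of simple algebras *)

Section Center.
Variables (R : realType) (M : cstarType R).
Implicit Types (x y z c w : M).

Lemma cnorm_normal (p c : M) : star p * p = p * star p ->
  cnorm (star p * c) = cnorm (p * c).
Proof.
move=> np; apply/eqP; rewrite -(eqrXn2 (n := 2)) ?cnorm_ge0 // -!cnorm_star.
by rewrite !starM starK -!mulrA [p * (star p * c)]mulrA -np !mulrA.
Qed.

(* With [p = y + i w] normal and [y = (p + star p) / 2], both estimates
   [`|y d| <= `|p d|] and [`|star p p c| = `|p p c|] are immediate. *)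
Lemma cnorm_sqr_sum y w c : star y = y -> star w = w -> y * w = w * y ->
  cnorm (y ^+ 2 * c) <= cnorm ((y ^+ 2 + w ^+ 2) * c).
Proof.
move=> sy sw yw; pose p := y + 'i%R *: w.
have sp : star p = y - 'i%R *: w.
  by rewrite starD starZ sy sw conjCi scaleNr.
have iw : ('i%R *: w) * ('i%R *: w) = - w ^+ 2.
  by rewrite -scalerAl -scalerAr scalerA -expr2 sqrCi scaleN1r expr2.
have yiw : y * ('i%R *: w) = ('i%R *: w) * y by rewrite -scalerAr -scalerAl yw.
have spp : star p * p = y ^+ 2 + w ^+ 2.
  rewrite sp mulrBl !mulrDr iw -expr2 yiw opprD opprK addrA.
  by rewrite -[y ^+ 2 + _ + _]addrA subrr addr0.
have pp : p * star p = y ^+ 2 + w ^+ 2.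
  rewrite sp mulrDl !mulrBr iw -expr2 yiw opprK addrA.
  by rewrite -[y ^+ 2 - _ + _]addrA [- _ + _]addrC subrr addr0.
have np : star p * p = p * star p by rewrite spp pp.
have yp d : cnorm (y * d) <= cnorm (p * d).
  have := cnormD_le (p * d) (star p * d).
  have -> : p * d + star p * d = (2%:R : R)%:C *: (y * d).
    rewrite -mulrDl sp addrACA subrr addr0 -mulr2n mulrnAl.
    by rewrite rmorph_nat scaler_nat.
  by rewrite cnorm_normal // cnormZr normr_nat; lra.
rewrite -spp -mulrA cnorm_normal //.
apply: le_trans (yp _); rewrite mulrA mulrDr yiw -mulrDl -/p.
rewrite -mulrA; apply: le_trans (yp _).
by rewrite mulrA.
Qed.

Section Simple.
Variable S : set M.
Hypotheses (subS : cstar_subalg S) (simS : simple_cstar S).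

Section Cesaro.
Variable z : M.
Hypotheses (Sz : S z) (sz : star z = z) (nz : cnorm z = 1).
Hypothesis cz : forall c, S c -> z * c = c * z.

(* The Cesaro mean of [1, z^2, ..., (z^2)^(2^p - 1)], in product form. *)
Let C p : M := \prod_(i < p) ((2^-1 : R)%:C *: (1 + z ^+ (2 ^ i.+1))).

Let C_comm p c : S c -> C p * c = c * C p.
Proof.
move=> Sc; apply/esym/commr_prod => i _; apply/esym.
rewrite /GRing.comm -scalerAl -scalerAr mulrDl mulrDr mul1r mulr1.
by congr (_ *: (_ + _)); apply/esym/commrX/esym/cz.
Qed.

Let zX n : cnorm (z ^+ n) <= 1.
Proof. by apply: le_trans (cnormX_le _ _) _; rewrite nz expr1n. Qed.

Let zX1 n : cnorm (z ^+ n) = 1.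
Proof.
have z2 k : cnorm (z ^+ (2 ^ k)) = 1.
  elim: k => [|k ih]; first by rewrite expn0 expr1.
  by rewrite expnSr exprM cnorm_self ?ih ?expr1n // starX sz.
apply/eqP; rewrite eq_le zX /= -(z2 n).
rewrite -(subnK (ltnW (ltn_expl n (ltnSn 1)))) exprD.
by apply: le_trans (cnormM_le _ _) _; rewrite ler_piMl ?cnorm_ge0.
Qed.

Let C_le1 p : cnorm (C p) <= 1.
Proof.
elim: p => [|p ih]; first by rewrite /C big_ord0 cnorm1.
rewrite /C big_ord_recr /=; apply: le_trans (cnormM_le _ _) _.
rewrite mulr_ile1 ?cnorm_ge0 // cnormZr ger0_norm ?invr_ge0 //.
have := cnormD_le 1 (z ^+ (2 ^ p.+1)); rewrite cnorm1 zX1; lra.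
Qed.

(** With [y = z ^+ (2 ^ p)], the square of the new factor is [y ^+ 2 + w ^+ 2] for
    [w = (1 - y ^+ 2) / 2], and [cnorm_sqr_sum] lets [w] be dropped. What remains is a power of [z],
    of norm 1; the arbitrary [c] lets the factors be replaced one at a time. *)
Let C_sqr_ge p : exists m, forall c, cnorm (z ^+ m * c) <= cnorm (C p ^+ 2 * c).
Proof.
elim: p => [|p [m ih]].
  by exists 0%N => c; rewrite /C big_ord0 expr1n expr0.
exists (m + 2 ^ p.+1)%N => c.
set y := z ^+ (2 ^ p); have y2 : z ^+ (2 ^ p.+1) = y ^+ 2 by rewrite expnSr exprM.
have Sy : S y by apply: subX.
set a := (2^-1 : R)%:C *: (1 + y ^+ 2).
set w := (2^-1 : R)%:C *: (1 - y ^+ 2).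
have CE : C p.+1 = C p * a by rewrite /C big_ord_recr /= y2.
have Sa : S a.
  by apply: subZ => //; apply: subD => //; [apply: subalg1|apply: subX].
have aE : a ^+ 2 = y ^+ 2 + w ^+ 2.
  have h t : (1 + t : M) ^+ 2 = (1 - t) ^+ 2 + t *+ 4.
    rewrite [1 + t]addrC -[1 - t]opprB sqrrN sqrrD1 sqrrB1 [RHS]addrAC.
    by rewrite (mulrnDr t 2 2) [in RHS]addrA subrK.
  rewrite /a /w !exprZn h scalerDr addrC; congr (_ + _).
  rewrite -scaler_nat scalerA -[RHS]scale1r; congr (_ *: _).
  by rewrite fmorphV rmorph_nat; field.
have Sw : S w by apply: subZ => //; apply: subB => //; [apply: subalg1|apply: subX].
have sy : star y = y by rewrite starX sz.
have yw : y * w = w * y.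
  by rewrite /w -scalerAr -scalerAl mulrBr mulrBl mulr1 mul1r -exprS -exprSr.
have sw : star w = w by rewrite starZr starB star1 starX sy.
have -> : C p.+1 ^+ 2 * c = (y ^+ 2 + w ^+ 2) * (C p ^+ 2 * c).
  by rewrite CE -aE C_comm // exprMn_comm ?mulrA //; apply/esym/C_comm.
apply: le_trans (cnorm_sqr_sum _ sy sw yw).
have -> : y ^+ 2 * (C p ^+ 2 * c) = C p ^+ 2 * (y ^+ 2 * c).
  by rewrite mulrA (commrX 2 (esym (C_comm p (subX subS 2 Sy)))) mulrA.
by apply: le_trans (ih _); rewrite exprD y2 mulrA.
Qed.

Let C_ge1 p : 1 <= cnorm (C p).
Proof.
have [m /(_ 1)] := C_sqr_ge p; rewrite !mulr1 zX1 => h.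
apply: le_trans h _; apply: le_trans (cnormX_le _ _) _.
by rewrite expr2 ler_piMl ?cnorm_ge0.
Qed.

Let C_telescope p : C p * (1 - z ^+ 2) = (2^-1 : R)%:C ^+ p *: (1 - z ^+ (2 ^ p.+1)).
Proof.
elim: p => [|p ih]; first by rewrite /C big_ord0 mul1r scale1r.
rewrite /C big_ord_recr /= -/(C p) C_comm; last first.
  by apply: subZ => //; apply: subD => //; [apply: subalg1|apply: subX].
rewrite -mulrA ih -scalerAl -scalerAr scalerA -exprS; congr (_ *: _).
by rewrite [(2 ^ p.+2)%N]expnSr exprM mulrDl mul1r mulrBr mulr1 addrA subrK expr2.
Qed.

(* [`|C p| >= 1] by [C_sqr_ge], while [C p * (1 - z^2)]
   tends to 0: so [I] is not [S], and [I = 0] gives [z^2 = 1]. *)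
Let I : set M := [set x | S x /\ small (fun p => cnorm (C p * x))].

Let I_ideal : closed_ideal S I.
Proof.
have ZE a x : cnorm (a *: x) <= cnorm (a *: 1 : M) * cnorm x.
  by rewrite -[x in X in X <= _]mul1r scalerAl cnormM_le.
split.
- by move=> x [].
- split; first exact: sub0.
  by move=> eps e0; exists 0%N => p _; rewrite mulr0 cnorm0.
- move=> a x y [Sx Ix] [Sy Iy]; split; first exact: subalgL.
  apply: (small_le ler01 _ (smallD (small_le (cnorm_ge0 (a *: 1 : M)) _ Ix) Iy)).
    by move=> p; rewrite mul1r mulrDr; apply: cnormD_le.
  by move=> p /=; rewrite -scalerAr ZE.
- move=> c x Sc [Sx Ix]; split; first exact: subalgM.
  apply: (small_le (cnorm_ge0 c) _ Ix) => p.
  by rewrite mulrA C_comm // -mulrA cnormM_le.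
- move=> x c [Sx Ix] Sc; split; first exact: subalgM.
  apply: (small_le (cnorm_ge0 c) _ Ix) => p.
  by rewrite mulrA mulrC cnormM_le.
- move=> x hx; have Sx : S x.
    by apply: (Defs.subalg_closed subS) => eps /hx [y [Sy _] ?]; exists y.
  split=> // eps e0; have e2 : 0 < eps / 2 by lra.
  have [y [_ Iy] xy] := hx _ e2; have [N hN] := Iy _ e2.
  exists N => p /hN h; have := cnorm_le_dist (C p * x) (C p * y).
  rewrite -mulrBr; have := cnormM_le (C p) (x - y).
  have : cnorm (C p) * cnorm (x - y) <= cnorm (x - y) by rewrite ler_piMl ?cnorm_ge0.
  by lra.
Qed.

Lemma simple_center_sqr : z ^+ 2 = 1.
Proof.
case: (simS I_ideal) => I0.
  apply/esym/eqP; rewrite -subr_eq0; apply/eqP; rewrite -[_ = 0]/([set 0] _) -I0.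
  have Sd : S (1 - z ^+ 2) by apply: subB => //; [apply: subalg1|apply: subX].
  split=> // eps e0; have [N hN] := exp_half_small (divr_gt0 e0 (ltr0n _ 2)).
  exists N => p Np; rewrite C_telescope -rmorphXn cnormZr.
  have := cnormB_le 1 (z ^+ (2 ^ p.+1)); rewrite zX1 cnorm1 => h.
  rewrite ger0_norm ?exprn_ge0 ?invr_ge0 //.
  have : (2^-1 : R) ^+ p <= 2^-1 ^+ N.
    rewrite -(subnK Np) exprD ler_piMl ?exprn_ge0 ?invr_ge0 //.
    by rewrite exprn_ile1 // ?invr_ge0 // invf_le1 // ler1n.
  have : 0 <= (2^-1 : R) ^+ p by rewrite exprn_ge0 // invr_ge0.
  have := cnorm_ge0 (1 - z ^+ (2 ^ p.+1)).
  by nra.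
have : I 1 by rewrite I0; apply: subalg1.
by move=> [_ /(_ _ ltr01) [N /(_ N (leqnn _))]]; rewrite mulr1 ltNge C_ge1.
Qed.

End Cesaro.

(** As [z ^+ 2 = 1], the element [z + 1] lies in the ideal of the [x] fixed by [z]: if that ideal is
    zero then [z = -1], and if it is everything then it contains 1 and [z = 1]. *)
Lemma simple_center_pm1 z : S z -> star z = z -> cnorm z = 1 ->
  (forall c, S c -> z * c = c * z) -> exists a : R[i], z = a *: 1.
Proof.
move=> Sz sz nz cz.
have z2 := simple_center_sqr Sz sz nz cz.
pose I : set M := [set x | S x /\ z * x = x].
have Ii : closed_ideal S I.
  split.
  - by move=> x [].
  - by split; rewrite ?mulr0 //; apply: sub0.
  - move=> a x y [Sx zx] [Sy zy]; split; first exact: subalgL.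
    by rewrite mulrDr -scalerAr zx zy.
  - move=> c x Sc [Sx zx]; split; first exact: subalgM.
    by rewrite mulrA cz // -mulrA zx.
  - move=> x c [Sx zx] Sc; split; first exact: subalgM.
    by rewrite mulrA zx.
  - move=> x hx; split.
      by apply: (Defs.subalg_closed subS) => eps /hx [y [Sy _] ?]; exists y.
    apply/eqP; rewrite -subr_eq0; apply/eqP/eq0_small => eps e0.
    have e2 : 0 < eps / 2 by lra.
    have [y [_ zy] xy] := hx _ e2.
    have -> : z * x - x = z * (x - y) - (x - y).
      by rewrite mulrBr zy opprB addrA subrK.
    have := cnormB_le (z * (x - y)) (x - y); have := cnormM_le z (x - y).
    by rewrite nz mul1r; lra.
case: (simS Ii) => I0.
  exists (-1); rewrite scaleN1r; apply/eqP; rewrite -addr_eq0; apply/eqP.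
  rewrite -[_ = 0]/([set 0] _) -I0; split; first by apply: subD => //; apply: subalg1.
  by rewrite mulrDr mulr1 -expr2 z2 addrC.
exists 1; rewrite scale1r; have : I 1 by rewrite I0; apply: subalg1.
by case=> _; rewrite mulr1.
Qed.

Lemma simple_center x : relcomm S S x -> exists a : R[i], x = a *: 1.
Proof.
have self z : S z -> star z = z -> (forall c, S c -> z * c = c * z) ->
    exists a : R[i], z = a *: 1.
  move=> Sz sz cz; have [z0|z0] := eqVneq z 0.
    by exists 0; rewrite z0 scale0r.
  have nz := cnorm_gt0 z0; pose t : R := (cnorm z)^-1.
  have [||||a aE] := @simple_center_pm1 (t%:C *: z).
  - exact: subZ.
  - by rewrite starZr sz.
  - by rewrite cnormZr ger0_norm ?invr_ge0 ?cnorm_ge0 // mulVf // gt_eqF.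
  - by move=> c Sc; rewrite -scalerAl -scalerAr cz.
  exists ((cnorm z)%:C * a); rewrite -scalerA -aE scalerA -rmorphM mulfV ?gt_eqF //.
  by rewrite scale1r.
move=> [Sx cx].
have csx c : S c -> star x * c = c * star x.
  by move=> Sc; rewrite -[c]starK -!starM cx //; apply: subalg_star.
have Ssx := subalg_star subS Sx.
have [||| a aE] := self (x + star x).
- exact: subD.
- by rewrite starD starK addrC.
- by move=> c Sc; rewrite mulrDl mulrDr cx // csx.
have [||| b bE] := self ('i%R *: (x - star x)).
- by apply: subZ => //; apply: subB.
- by rewrite starZ conjCi starB starK -[x - _]opprB scalerN scaleNr.
- by move=> c Sc; rewrite -scalerAl -scalerAr mulrBl mulrBr cx // csx.
exists ((2^-1 : R)%:C * (a - 'i%R * b)).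
rewrite -scalerA scalerBl -aE -scalerA -bE scalerA -expr2 sqrCi scaleN1r opprK.
rewrite addrACA subrr addr0 -mulr2n -scaler_nat scalerA fmorphV rmorph_nat.
by rewrite mulVf ?pnatr_eq0 // scale1r.
Qed.

End Simple.
End Center.

(** * Conditional expectations and minimality *)

Section CondExp.
Variables (R : realType) (M : cstarType R) (A B : set M) (E : M -> M).
Hypotheses (subA : cstar_subalg A) (subB : cstar_subalg B) (BA : B `<=` A).
Hypothesis expE : cond_exp A B E.
Implicit Types (x y : M).

Lemma cexp0 : E 0 = 0.
Proof. by apply: (cexp_id expE); apply: sub0. Qed.

Lemma cexp1 : E 1 = 1.
Proof. by apply: (cexp_id expE); apply: subalg1. Qed.

Lemma cexpZ (a : R[i]) x : A x -> E (a *: x) = a *: E x.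
Proof.
by move=> Ax; rewrite -[a *: x]addr0 (cexpL expE) //; [rewrite cexp0 addr0|apply: sub0].
Qed.

Lemma cexpD x y : A x -> A y -> E (x + y) = E x + E y.
Proof. by move=> Ax Ay; rewrite -[x]scale1r (cexpL expE) // !scale1r. Qed.

Lemma cexpN x : A x -> E (- x) = - E x.
Proof. by move=> Ax; rewrite -scaleN1r cexpZ // scaleN1r. Qed.

Lemma cexpB x y : A x -> A y -> E (x - y) = E x - E y.
Proof. by move=> Ax Ay; rewrite cexpD ?cexpN //; apply: subN. Qed.

Lemma cexp_sum (I : eqType) (r : seq I) (F : I -> M) :
  {in r, forall i, A (F i)} -> E (\sum_(i <- r) F i) = \sum_(i <- r) E (F i).
Proof.
elim: r => [|i r ih] AF; first by rewrite !big_nil cexp0.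
have Ar : {in r, forall i, A (F i)} by move=> j jr; apply: AF; rewrite inE jr orbT.
rewrite !big_cons cexpD ?ih //; first by apply: AF; rewrite mem_head.
exact: sub_sum.
Qed.

Lemma cexpMl b x : B b -> A x -> E (b * x) = b * E x.
Proof.
move=> Bb Ax; rewrite -[b * x]mulr1 (cexpM expE) ?mulr1 //; exact: subalg1.
Qed.

Lemma cexpMr x b : A x -> B b -> E (x * b) = E x * b.
Proof.
move=> Ax Bb; rewrite -[x in LHS]mul1r (cexpM expE) ?mul1r //; exact: subalg1.
Qed.

(** Positivity only says that each [E (star y * y)] is self-adjoint. Polarising at [1 + y] makes
    [E y + E (star y)] self-adjoint; taking for [y] both [x] and [i x] separates the two terms. *)
Lemma cexp_star x : A x -> E (star x) = star (E x).
Proof.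
move=> Ax; have Asx := subalg_star subA Ax; have A1 := subalg1 subA.
have self y : A y -> star (E y + E (star y)) = E y + E (star y).
  move=> Ay; have Asy := subalg_star subA Ay.
  have : E (star (1 + y) * (1 + y)) = E (1 + star y * y) + (E y + E (star y)).
    have AM := subalgM subA Asy Ay.
    have A1M := subD subA A1 AM.
    rewrite -!cexpD //; last by apply: subD.
    rewrite starD star1 mulrDl mul1r mulrDr mulr1; congr (E _).
    by rewrite [star y + _]addrC addrACA.
  have [z _ ->] := cexp_ge0 expE (subD subA A1 Ay).
  have -> : E (1 + star y * y) = 1 + E (star y * y).
    by rewrite cexpD ?cexp1 //; apply: subalgM.
  have [w _ ->] := cexp_ge0 expE Ay.
  move=> h; have -> : E y + E (star y) = star z * z - (1 + star w * w).
    by rewrite h addrAC subrr add0r.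
  by rewrite !(starD, starN, starM, starK, star1).
have h1 := self x Ax.
have := self ('i%R *: x) (subZ subA _ Ax).
rewrite starZ conjCi !scaleNr cexpN ?cexpZ //; last exact: subZ.
rewrite -scalerBr starZ conjCi scaleNr -scalerN.
move=> /(scalerI (neq0Ci _)) => h2.
move: h1 h2; rewrite !starD starN opprB => h1 h2.
have : star (E x) + star (E (star x)) + (star (E (star x)) - star (E x)) = E x + E (star x) + (E x - E (star x)).
  by rewrite h1 h2.
rewrite [star (E x) + _]addrC addrACA subrr addr0.
rewrite [in RHS]addrACA subrr addr0 -!mulr2n => /(congr1 (fun z => (2^-1 : R[i]) *: z)).
rewrite -(scaler_nat 2 (star _)) -(scaler_nat 2 (E x)) !scalerA mulVf ?pnatr_eq0 // !scale1r.
by move=> /(congr1 (@star _ _)); rewrite starK.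
Qed.

End CondExp.

(* The derivative at [d = 0] of [(1 - 2 d a + d^2 b) g], a function which has the
   lower bound [c] and equals [c] at [d = 0], is [2 (t - c a)]. *)
Lemma first_order_le (R : realType) (c a t b K h : R) :
  0 <= K -> 0 <= h ->
  (forall d : R, 0 < d -> d * h <= 2^-1 -> 0 < 1 - 2 * d * a + d ^+ 2 * b ->
    exists2 g, `|g - c - 2 * d * t| <= d ^+ 2 * K
      & c <= (1 - 2 * d * a + d ^+ 2 * b) * g) ->
  c * a <= t.
Proof.
move=> K0 h0 hyp; rewrite leNgt; apply/negP => X0.
pose X := c * a - t; have {}X0 : 0 < X by rewrite subr_gt0.
pose L : R := `|K + b * c - 4 * a * t| + `|2 * t * b - 2 * a * K| + `|b * K|.
have L0 : 0 <= L by rewrite !addr_ge0.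
(* The four summands make [d = D^-1] small enough for, in turn, [d <= 1], [d * h <= 1/2], positivity
   of the quadratic factor and [d * L <= X]. Then [2 * X <= d * L <= X] contradicts [0 < X]. *)
pose D := 1 + 2 * h + (2 * `|a| + `|b|) + L / X.
have LX0 : 0 <= L / X by rewrite divr_ge0 // ltW.
have a0 := normr_ge0 a; have b0 := normr_ge0 b.
have D1 : 1 <= D by rewrite /D; lra.
have D0 : 0 < D by lra.
pose d := D^-1; have d0 : 0 < d by rewrite invr_gt0.
have dD : d * D = 1 by rewrite mulVf // gt_eqF.
have d1 : d <= 1 by rewrite invf_le1.
have dE : d + 2 * (d * h) + d * (2 * `|a| + `|b|) + d * (L / X) = 1.
  by rewrite -[RHS]dD; move: (d); rewrite /D => d'; ring.
clearbody d.
have dh0 : 0 <= d * h by rewrite mulr_ge0 // ltW.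
have dab0 : 0 <= d * (2 * `|a| + `|b|) by rewrite mulr_ge0; lra.
have dLX0 : 0 <= d * (L / X) by rewrite mulr_ge0 // ltW.
have dd : d ^+ 2 <= d by rewrite expr2 ler_piMr // ltW.
have dd0 : 0 < d ^+ 2 by rewrite exprn_gt0.
have aN := ler_norm a; have bN : - b <= `|b| by rewrite -normrN ler_norm.
have pos : 0 < 1 - 2 * d * a + d ^+ 2 * b.
  have : d * a <= d * `|a| by rewrite ler_wpM2l // ltW.
  have : d ^+ 2 * - b <= d ^+ 2 * `|b| by rewrite ler_wpM2l // ltW.
  have : d ^+ 2 * `|b| <= d * `|b| by rewrite ler_wpM2r.
  by move: dE; lra.
have [|g gN gc] := hyp d d0 _ pos; first by move: dE; lra.
have gle : g <= c + 2 * d * t + d ^+ 2 * K.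
  have := ler_norm (g - c - 2 * d * t); lra.
have := ler_wpM2l (ltW pos) gle; move: gc => /le_trans h1 /h1 h2.
have dL : d * L <= X.
  have : d * (L / X) <= 1 by move: dE; lra.
  by rewrite mulrA ler_pdivrMr // mul1r.
have : 2 * X <= d * (K + b * c - 4 * a * t) + d ^+ 2 * (2 * t * b - 2 * a * K) + d ^+ 3 * (b * K).
  rewrite -(ler_pM2l d0) -subr_ge0.
  move: h2; rewrite -subr_ge0 /X; congr (0 <= _); ring.
have : d * (K + b * c - 4 * a * t) <= d * `|K + b * c - 4 * a * t|.
  by rewrite ler_wpM2l ?ler_norm // ltW.
have : d ^+ 2 * (2 * t * b - 2 * a * K) <= d * `|2 * t * b - 2 * a * K|.
  apply: le_trans (ler_wpM2l (ltW dd0) (ler_norm _)) _.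
  by rewrite ler_wpM2r.
have : d ^+ 3 * (b * K) <= d * `|b * K|.
  apply: le_trans (ler_wpM2l _ (ler_norm _)) _; first by rewrite exprn_ge0 // ltW.
  rewrite ler_wpM2r // exprS; apply: le_trans dd.
  by rewrite ler_piMl // ltW.
by move: dL; rewrite /L; lra.
Qed.

(** Expanding [p.2 * a] on one side and [a * p.1] on the other gives the same double sum up to the
    place of [P (p.2 * a * r.1)], which passes [y]. It serves for [E] and for the composites
    [Phi s k]. *)
Lemma quasi_central (R : realType) (M : cstarType R) (A B : set M) (P : M -> M)
    (Q : seq (M * M)) (y : M) :
  (forall x z, A x -> A z -> A (x * z)) ->
  {in Q, forall p, A p.1 /\ A p.2} ->
  (forall x, A x -> B (P x)) ->
  (forall x, A x -> \sum_(p <- Q) p.1 * P (p.2 * x) = x) ->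
  (forall x, A x -> \sum_(p <- Q) P (x * p.1) * p.2 = x) ->
  (forall b, B b -> y * b = b * y) ->
  forall a, A a ->
    (\sum_(p <- Q) p.1 * y * p.2) * a = a * \sum_(p <- Q) p.1 * y * p.2.
Proof.
move=> AM Qin PB Ql Qr cy a Aa; rewrite mulr_suml mulr_sumr.
have -> : \sum_(p <- Q) p.1 * y * p.2 * a
    = \sum_(p <- Q) \sum_(r <- Q) p.1 * y * P (p.2 * a * r.1) * r.2.
  apply: eq_big_seq => p /Qin [Ap1 Ap2].
  rewrite -mulrA -{1}(Qr (p.2 * a)); last exact: AM.
  by rewrite mulr_sumr; apply: eq_bigr => r _; rewrite !mulrA.
have -> : \sum_(p <- Q) a * (p.1 * y * p.2)
    = \sum_(p <- Q) \sum_(r <- Q) r.1 * P (r.2 * a * p.1) * y * p.2.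
  apply: eq_big_seq => p /Qin [Ap1 Ap2].
  rewrite !mulrA -{1}(Ql (a * p.1)); last exact: AM.
  by rewrite !mulr_suml; apply: eq_bigr => r _; rewrite !mulrA.
rewrite exchange_big; apply: eq_big_seq => r /Qin [Ar1 Ar2].
apply: eq_big_seq => p /Qin [Ap1 Ap2].
have Bz : B (P (p.2 * a * r.1)) by apply: PB; apply: (AM) => //; apply: AM.
by rewrite -[p.1 * y * _]mulrA cy // mulrA.
Qed.

(** * Minimality and the index on the relative commutant *)

Section Minimal.
Variables (R : realType) (M : cstarType R) (A B : set M) (E : M -> M) (c : R).
Variable s : seq M.
Hypotheses (algA : cstar_subalg A) (algB : cstar_subalg B) (BA : B `<=` A).
Hypotheses (simA : simple_cstar A) (simB : simple_cstar B).
Hypotheses (expE : cond_exp A B E) (qbE : quasi_basis A E s).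
Hypothesis idxE : \sum_(l <- s) l * star l = c%:C *: 1.
Hypothesis minE : forall E' c', has_index A B E' c' -> c <= c'.
Implicit Types x y z h : M.

Let th y := \sum_(l <- s) l * y * star l.

Let As : {in s, forall l, A l}. Proof. by case: qbE. Qed.

Let qbl x : A x -> \sum_(l <- s) l * E (star l * x) = x.
Proof. by case: qbE => _ h /h []. Qed.

Let qbr x : A x -> \sum_(l <- s) E (x * l) * star l = x.
Proof. by case: qbE => _ h /h []. Qed.

Let AM x y : A x -> A y -> A (x * y). Proof. exact: subalgM. Qed.
Let Astar x : A x -> A (star x). Proof. exact: subalg_star. Qed.
Let A1 : A 1. Proof. exact: subalg1. Qed.
Let AZ a x : A x -> A (a *: x). Proof. exact: subZ. Qed.
Let AD x y : A x -> A y -> A (x + y). Proof. exact: subD. Qed.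
Let AB x y : A x -> A y -> A (x - y). Proof. exact: subB. Qed.

Let thD x y : th (x + y) = th x + th y.
Proof. by rewrite -big_split; apply: eq_bigr => l _; rewrite mulrDr mulrDl. Qed.

Let thZ a x : th (a *: x) = a *: th x.
Proof.
by rewrite scaler_sumr; apply: eq_bigr => l _; rewrite -scalerAr -scalerAl.
Qed.

Let th1 : th 1 = c%:C *: 1.
Proof. by rewrite -idxE; apply: eq_bigr => l _; rewrite mulr1. Qed.

Let th_star y : star (th y) = th (star y).
Proof. by rewrite star_sum; apply: eq_bigr => l _; rewrite !starM starK mulrA. Qed.

Let th_scalar y : relcomm B A y -> exists a : R[i], th y = a *: 1.
Proof.
move=> [Ay cy]; apply: (simple_center algA simA); split.
  by apply: sub_sum => // l ls; apply: (AM); [apply: (AM) => //; exact: As|apply/Astar/As].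
have -> : th y = \sum_(p <- [seq (l, star l) | l <- s]) p.1 * y * p.2.
  by rewrite big_map.
apply: (quasi_central (A := A) (B := B) (P := E)) => //.
- by move=> p /mapP [l ls ->]; split; [exact: As|apply/Astar/As].
- exact: (cexp_in expE).
- by move=> x Ax; rewrite big_map qbl.
- by move=> x Ax; rewrite big_map qbr.
Qed.

Let E_scalar y : relcomm B A y -> exists a : R[i], E y = a *: 1.
Proof.
move=> [Ay cy]; apply: (simple_center algB simB).
have BEy : B (E y) by apply: (cexp_in expE).
split=> // b Bb; rewrite -(cexpMr algB expE) // -(cexpMl algB expE) //.
by rewrite cy.
Qed.

Let th_le y : cnorm (th y) <= (\sum_(l <- s) cnorm l * cnorm (star l)) * cnorm y.
Proof.
apply: le_trans (cnorm_sum _ _) _; rewrite mulr_suml; apply: ler_sum => l _.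
apply: le_trans (cnormM_le _ _) _; rewrite mulrAC ler_wpM2r ?cnorm_ge0 //.
exact: cnormM_le.
Qed.

Let relM y z : relcomm B A y -> relcomm B A z -> relcomm B A (y * z).
Proof.
move=> [Ay cy] [Az cz]; split=> [|b Bb]; first exact: AM.
by rewrite -mulrA cz // mulrA cy // mulrA.
Qed.

Lemma has_index_conj (k g : M) (r m : R) :
  relcomm B A k -> relcomm B A g -> star k = k -> star g = g ->
  g * k = 1 -> k * g = 1 -> 0 < r ->
  E (k * k) = r%:C *: 1 -> th (g * g) = m%:C *: 1 ->
  has_index A B (fun x => (r^-1)%:C *: E (k * x * k)) (r * m).
Proof.
move=> [Ak kB] [Ag gB] sk sg gk kg r0 Ekk thgg; set E' := fun x => _.
have Akk x : A x -> A (k * x * k) by move=> Ax; do 2?apply: (AM) => //.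
have BE x : A x -> B (E x) by exact: (cexp_in expE).
have Als l : l \in s -> A (star l) by move=> ls; apply/Astar/As.
have rr : (r^-1)%:C *: (r%:C *: (1 : M)) = 1.
  by rewrite scalerA -rmorphM mulVf ?scale1r // gt_eqF.
pose rt := Num.sqrt r; have rtE : rt * rt = r by rewrite -expr2 sqr_sqrtr // ltW.
have rtV : rt * (r^-1 * rt) = 1 by rewrite mulrCA rtE mulVf // gt_eqF.
split; first split.
- by move=> x Ax; apply: (subZ algB); apply: BE; apply: Akk.
- move=> z x y Ax Ay; rewrite /E' mulrDr mulrDl -scalerAr -scalerAl.
  by rewrite (cexpL expE) ?scalerDr ?scalerA 1?[_ * z]mulrC //; apply: Akk.
- move=> x Bx; rewrite /E' kB // -mulrA (cexpMl algB expE) //; last exact: AM.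
  by rewrite Ekk scalerAr rr mulr1.
- move=> x y z Bx Ay Bz; rewrite /E' !mulrA kB // -[_ * z * k]mulrA -(kB z) //.
  have -> : x * k * y * (k * z) = x * (k * y * k) * z by rewrite !mulrA.
  rewrite (cexpM expE) //; last exact: Akk.
  by rewrite -scalerAr -scalerAl.
- move=> x Ax; have [y By yE] := cexp_ge0 expE (AM Ax Ak).
  exists ((Num.sqrt r^-1)%:C *: y); first exact: (subZ algB).
  rewrite /E' !mulrA -{1}sk -starM -mulrA yE starZr -scalerAl -scalerAr.
  by rewrite scalerA -rmorphM -expr2 sqr_sqrtr // invr_ge0 ltW.
exists [seq rt%:C *: (l * g) | l <- s]; first split.
- move=> l /mapP [l' l's ->]; apply: AZ; apply: (AM) => //; exact: As.
- move=> x Ax; rewrite !big_map; split.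
    rewrite -{1}[x]mulr1 -kg mulrA -{1}(qbl (AM Ax Ak)) mulr_suml.
    apply: eq_big_seq => l ls; have Alx := AM (Als l ls) (AM Ax Ak).
    have e1 : k * (star (rt%:C *: (l * g)) * x) * k = rt%:C *: (star l * (x * k)).
      rewrite starZr starM sg -scalerAl -scalerAr -scalerAl; congr (_ *: _).
      by rewrite !mulrA kg mul1r.
    rewrite /E' e1 (cexpZ algA algB expE) // -scalerAl -!scalerAr !scalerA.
    by rewrite -!rmorphM -mulrA rtV scale1r -!mulrA gB //; apply: BE.
  rewrite -{1}[x]mul1r -gk -mulrA -{1}(qbr (AM Ak Ax)) mulr_sumr.
  apply: eq_big_seq => l ls; have Alx := AM (AM Ak Ax) (As ls).
  have e1 : k * (x * (rt%:C *: (l * g))) * k = rt%:C *: (k * x * l).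
    rewrite -!scalerAr -scalerAl; congr (_ *: _).
    by rewrite -!mulrA gk mulr1.
  rewrite /E' e1 (cexpZ algA algB expE) // starZr starM sg -scalerAr -!scalerAl.
  rewrite [_ *: (rt%:C *: _)]scalerA scalerA -!rmorphM rtV scale1r !mulrA.
  by rewrite gB //; apply: BE.
- rewrite big_map rmorphM -scalerA -thgg -thZ; apply: eq_big_seq => l ls.
  rewrite starZr starM sg -scalerAl -!scalerAr -scalerAl scalerA -rmorphM rtE.
  by rewrite !mulrA.
Qed.

Section Perturb.
Variables (h : M) (a t b d : R).
Hypotheses (Bh : relcomm B A h) (sh : star h = h).
Hypotheses (Eh : E h = a%:C *: 1) (Ehh : E (h * h) = b%:C *: 1).
Hypothesis thh : th h = t%:C *: 1.
Hypotheses (d0 : 0 < d) (dh : d * cnorm h <= 2^-1).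
Hypothesis cd0 : 0 < 1 - 2 * d * a + d ^+ 2 * b.
Let cd : R := 1 - 2 * d * a + d ^+ 2 * b.
Let k : M := 1 - d%:C *: h.

Let Ah : A h. Proof. by case: Bh. Qed.
Let Ak : A k. Proof. by apply: AB => //; apply: AZ. Qed.

Let kB x : B x -> k * x = x * k.
Proof.
move=> Bx; rewrite mulrBl mulrBr mul1r mulr1 -scalerAl -scalerAr.
by case: Bh => _ ->.
Qed.

Let Ekk : E (k * k) = cd%:C *: 1.
Proof.
have -> : k * k = 1 - (2 * d)%:C *: h + (d ^+ 2)%:C *: (h * h).
  rewrite /k mulrBl mul1r mulrBr mulr1 -scalerAl -scalerAr scalerA -rmorphM -expr2.
  by rewrite opprB addrA addrAC -[1 - _ - _]addrA -opprD -scalerDl -rmorphD mulr_natl.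
have Ahh : A (h * h) by apply: AM.
rewrite (cexpD expE); [|by apply: AB => //; apply: AZ|exact: AZ].
rewrite (cexpB algA algB expE) //; last exact: AZ.
rewrite !(cexpZ algA algB expE) //.
rewrite (cexp1 algB expE) Eh Ehh !scalerA -!rmorphM -{1}[1]scale1r -scalerBl -scalerDl.
by rewrite -[1]/(1%:C) -rmorphB -rmorphD.
Qed.

Let sk : star k = k.
Proof. by rewrite starB star1 starZr sh. Qed.

(* The index of [cd^-1 E(k . k)] is [cd * g], where [th (k^-2)] is the scalar [g],
   which [c + 2 d t] approximates to second order in [d]. *)
Lemma perturbed_index : exists2 g : R,
  `|g - c - 2 * d * t| <=
    d ^+ 2 * ((\sum_(l <- s) cnorm l * cnorm (star l)) * (8 * cnorm h ^+ 2))
  & c <= cd * g.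
Proof.
have [||g [Ag gk kg gle]] := @neumann R M A (d%:C *: h) algA.
- exact: AZ.
- by rewrite cnormZr gtr0_norm.
rewrite -/k in gk kg.
have sg : star g = g.
  by rewrite -[LHS]mulr1 -kg mulrA -{1}sk -starM kg star1 mul1r.
have gB x : B x -> g * x = x * g.
  by move=> Bx; rewrite -[g * x]mulr1 -kg mulrA -[g * x * k]mulrA -kB // mulrA gk mul1r.
have Bg : relcomm B A g by split.
have [z zE] := th_scalar (relM Bg Bg).
have [|gm gmE] := @self_scale1 R M z.
  by rewrite -zE th_star starM sg.
rewrite gmE in zE; exists gm.
  (* [d ^+ 2 *: r] is the remainder in [(1 - u)^-2 = 1 + 2 u + u^2 (2 g + g^2)]; [cnorm g <= 2]
     bounds the last bracket by 8, the constant in the statement. *)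
  pose u := d%:C *: h; pose r := h * h * (g + g + g * g).
  have gu : g = 1 + u * g.
    by rewrite -kg mulrBl mul1r subrK.
  have ug : g * u = u * g.
    have -> : u = 1 - k by rewrite /k opprB addrC subrK.
    by rewrite mulrBr mulrBl gk kg mulr1 mul1r.
  have uu : u * u = (d ^+ 2)%:C *: (h * h).
    by rewrite -scalerAl -scalerAr scalerA -rmorphM expr2.
  have ggE : g * g = 1 + (2 * d)%:C *: h + (d ^+ 2)%:C *: r.
    have e1 : g * g = g + u * (g * g) by rewrite {2}gu mulrDr mulr1 mulrA ug mulrA.
    have e2 : u * g = u + u * u * g by rewrite {1}gu mulrDr mulr1 mulrA.
    have e3 : u * (g * g) = u + u * u * g + u * u * (g * g).
      by rewrite {1}e1 mulrDr e2 mulrA.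
    rewrite {1}e1 e3 {1}gu e2 /r scalerAl -uu !mulrDr.
    have -> : (2 * d)%:C *: h = u + u by rewrite mulr_natl rmorphMn mulr2n scalerDl.
    rewrite !addrA; congr (_ + _); rewrite -!addrA; congr (1 + (u + _)).
    by rewrite addrCA.
  have key : (gm - c - 2 * d * t)%:C *: (1 : M) = (d ^+ 2)%:C *: th r.
    rewrite !rmorphB !scalerBl -zE -th1 ggE !thD !thZ thh scalerA -rmorphM.
    by rewrite -[LHS]addrA -opprD addrAC subrr add0r.
  have := congr1 (@cnorm R M) key.
  rewrite cnorm_scale1 cnormZr normrX (gtr0_norm d0) => ->.
  rewrite ler_wpM2l ?exprn_ge0 ?(ltW d0) //; apply: le_trans (th_le _) _.
  apply: ler_wpM2l.
    by apply: sumr_ge0 => l _; rewrite mulr_ge0 ?cnorm_ge0.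
  apply: le_trans (cnormM_le _ _) _; rewrite mulrC.
  apply: ler_pM; rewrite ?cnorm_ge0 //; last by rewrite expr2 cnormM_le.
  apply: le_trans (cnormD_le _ _) _.
  have := cnormD_le g g; have := cnormM_le g g; have := cnorm_ge0 g.
  by move: gle; nra.
have Bk : relcomm B A k by split.
by apply/minE/(has_index_conj Bk Bg).
Qed.
End Perturb.

Let minimal_le h (a t : R) : relcomm B A h -> star h = h ->
  E h = a%:C *: 1 -> th h = t%:C *: 1 -> c * a <= t.
Proof.
move=> Bh sh Eh thh; have [Ah _] := Bh.
have Bhh := relM Bh Bh; have [z zE] := E_scalar Bhh.
have [|b bE] := @self_scale1 R M z.
  by rewrite -zE -(cexp_star algA algB expE) ?starM ?sh //; apply: (AM).
rewrite bE in zE.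
apply: (@first_order_le R c a t b
  ((\sum_(l <- s) cnorm l * cnorm (star l)) * (8 * cnorm h ^+ 2)) (cnorm h)).
- rewrite mulr_ge0 //; last by rewrite mulr_ge0 // exprn_ge0 // cnorm_ge0.
  by apply: sumr_ge0 => l _; rewrite mulr_ge0 ?cnorm_ge0.
- exact: cnorm_ge0.
- by move=> d d0 dh cd0; apply: perturbed_index thh d0 dh cd0.
Qed.

Let minimal_self h : relcomm B A h -> star h = h -> th h = c%:C *: E h.
Proof.
move=> Bh sh; have [Ah ch] := Bh.
have [z zE] := E_scalar Bh; have [|a aE] := @self_scale1 R M z.
  by rewrite -zE -(cexp_star algA algB expE) ?sh.
have [w wE] := th_scalar Bh; have [|t tE] := @self_scale1 R M w.
  by rewrite -wE th_star sh.
rewrite aE in zE; rewrite tE in wE; rewrite zE wE scalerA -rmorphM.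
congr (_%:C *: _); apply/eqP; rewrite eq_le (minimal_le Bh sh zE wE) andbT.
(* Perturbing in the direction [- h] gives the opposite inequality. *)
rewrite -lerN2 -mulrN; apply: (@minimal_le (- h)).
- by split=> [|b Bb]; [apply: (subN algA)|rewrite mulNr mulrN ch].
- by rewrite starN sh.
- by rewrite (cexpN algA algB expE) // zE rmorphN scaleNr.
- by rewrite -(scaleN1r h) thZ wE rmorphN scaleN1r scaleNr.
Qed.

(** The perturbation asks for a self-adjoint [h], so the identity is obtained for the real and
    imaginary parts of [y] and recombined by linearity. *)
Lemma minimal_index y : relcomm B A y -> \sum_(l <- s) l * y * star l = c%:C *: E y.
Proof.
move=> By; have [Ay cy] := By; have Asy := Astar Ay.
have csy b : B b -> star y * b = b * star y.
  by move=> Bb; rewrite -[b]starK -!starM cy //; apply: (subalg_star algB).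
rewrite -/(th y); pose x1 := y + star y; pose x2 := 'i%R *: (y - star y).
have yE : y = (2^-1 : R[i]) *: (x1 - 'i%R *: x2).
  rewrite /x2 scalerA -expr2 sqrCi scaleN1r opprK addrACA subrr addr0 -mulr2n.
  by rewrite -(scaler_nat 2 y) scalerA mulVf ?pnatr_eq0 // scale1r.
have B1 : relcomm B A x1.
  by split=> [|b Bb]; [apply: AD|rewrite mulrDl mulrDr cy ?csy].
have B2 : relcomm B A x2.
  split=> [|b Bb]; first by apply: AZ; apply: (AB).
  by rewrite -scalerAl -scalerAr mulrBl mulrBr cy ?csy.
have [A1' _] := B1; have [A2' _] := B2.
have h1 : th x1 = c%:C *: E x1 by apply: minimal_self; rewrite // starD starK addrC.
have h2 : th x2 = c%:C *: E x2.
  apply: minimal_self => //.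
  by rewrite /x2 starZ conjCi starB starK -[star y - y]opprB scalerN scaleNr opprK.
clearbody x1 x2.
have -> : E y = (2^-1 : R[i]) *: (E x1 - 'i%R *: E x2).
  rewrite {1}yE (cexpZ algA algB expE); last by apply: (AB) => //; apply: AZ.
  rewrite (cexpB algA algB expE) //; last exact: AZ.
  by rewrite (cexpZ algA algB expE).
rewrite {1}yE thZ thD -(scaleN1r ('i%R *: x2)) !thZ h1 h2 scaleN1r.
rewrite [RHS]scalerA [RHS]scalerBr [LHS]scalerBr !scalerA.
by congr (_ - _); congr (_ *: _); ring.
Qed.

End Minimal.

(** * Relations of the Jones projection *)

Section BasicConstruction.
Variables (R : realType) (M : cstarType R) (A B D : set M) (E : M -> M) (e : M).
Variable Q : seq (M * M).
Hypotheses (algA : cstar_subalg A) (algB : cstar_subalg B) (algD : cstar_subalg D).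
Hypotheses (BA : B `<=` A) (expE : cond_exp A B E).
Hypothesis Qin : {in Q, forall p, A p.1 /\ A p.2}.
Hypothesis Ql : forall x, A x -> \sum_(p <- Q) p.1 * E (p.2 * x) = x.
Hypothesis Qr : forall x, A x -> \sum_(p <- Q) E (x * p.1) * p.2 = x.
Hypothesis bcD : basic_construction A E D e.

(** [pi] is faithful, so each identity is checked on operators on [A], where [e] acts as [E].
    Self-adjointness also uses that the form [E (star x * y)] is nondegenerate, which the
    quasi-basis ensures. *)
Lemma basic_jones : [/\ star e = e, forall x, A x -> e * x * e = E x * e
  & \sum_(p <- Q) p.1 * e * p.2 = 1].
Proof.
have [AD De _ [pi pi_iso]] := bcD.
have Dse : D (star e) := subalg_star algD De.
have BE x : A x -> B (E x) by exact: (cexp_in expE).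
have AE x : A x -> A (E x) by move=> /BE /BA.
have D1 : D 1 := subalg1 algD.
have piB d d' x : D d -> D d' -> A x -> pi (d - d') x = pi d x - pi d' x.
  by move=> *; rewrite -scaleN1r addrC (bc_linear pi_iso) // scaleN1r addrC.
have pi_eq d d' : D d -> D d' -> (forall x, A x -> pi d x = pi d' x) -> d = d'.
  move=> Dd Dd' h; apply/eqP; rewrite -subr_eq0; apply/eqP/(bc_inj pi_iso).
    exact: (subB algD).
  by move=> x Ax; rewrite piB // h // subrr.
have nondeg z : A z -> (forall x, A x -> E (star z * x) = 0) -> z = 0.
  move=> Az h; apply: (can_inj (@starK R M)); rewrite star0 -[LHS]Qr; last first.
    exact: (subalg_star algA).
  by apply: big1_seq => p /andP[_ /Qin [? ?]]; rewrite h // mul0r.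
have pi_sum (r : seq (M * M)) x : {in r, forall p, A p.1 /\ A p.2} -> A x ->
    D (\sum_(p <- r) p.1 * e * p.2) /\
    pi (\sum_(p <- r) p.1 * e * p.2) x = \sum_(p <- r) p.1 * E (p.2 * x).
  move=> rA Ax; elim: r rA => [|p r ih] rA.
    rewrite !big_nil; split; first exact: (sub0 algD).
    by rewrite (bc_lambda pi_iso) ?mul0r //; apply: (sub0 algA).
  have [|ih1 ih2] := ih; first by move=> i ir; apply: rA; rewrite inE ir orbT.
  have [Ap1 Ap2] := rA p (mem_head _ _).
  have Dp1 := AD _ Ap1; have Dp2 := AD _ Ap2.
  have Dp1e := subalgM algD Dp1 De.
  have Dp := subalgM algD Dp1e Dp2.
  have Ap2x := subalgM algA Ap2 Ax.
  rewrite !big_cons; split; first exact: (subD algD).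
  rewrite -[p.1 * _ * _]scale1r (bc_linear pi_iso) // scale1r ih2; congr (_ + _).
  rewrite (bc_mul pi_iso) // (bc_mul pi_iso) //; last by rewrite (bc_lambda pi_iso).
  rewrite (bc_lambda pi_iso Ap2) // (bc_jones pi_iso) //.
  by rewrite (bc_lambda pi_iso) //; apply: AE.
have se : star e = e.
  apply: pi_eq => // x Ax; rewrite (bc_jones pi_iso) //.
  have [_ Ase _] := bc_star pi_iso De Ax Ax.
  apply/eqP; rewrite -subr_eq0; apply/eqP/nondeg; first by apply: (subB algA) => //; apply: AE.
  move=> y Ay; have [_ _ h] := bc_star pi_iso De Ax Ay.
  rewrite starB mulrBl (cexpB algA algB expE); last first.
  - by apply: (subalgM algA) => //; apply: (subalg_star algA); apply: AE.
  - by apply: (subalgM algA) => //; apply: (subalg_star algA).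
  rewrite h (bc_jones pi_iso) // (cexpMr algB expE); [|exact: (subalg_star algA)|exact: BE].
  rewrite (cexpMl algB expE) //; last by apply: (subalg_star algB); apply: BE.
  by rewrite (cexp_star algA algB expE) // subrr.
split=> //.
  move=> x Ax; have Dx := AD _ Ax; have Dex := subalgM algD De Dx.
  have DEx := AD _ (AE x Ax).
  apply: pi_eq; try exact: (subalgM algD).
  move=> y Ay; have AEy := AE y Ay.
  rewrite (bc_mul pi_iso) // (bc_jones pi_iso) // (bc_mul pi_iso) //.
  rewrite (bc_lambda pi_iso Ax) // (bc_jones pi_iso); last exact: (subalgM algA).
  rewrite (bc_mul pi_iso) // (bc_jones pi_iso) // (bc_lambda pi_iso) //; last exact: AE.
  by rewrite (cexpMr algB expE) //; apply: BE.
apply: pi_eq => //; first by have [] := pi_sum Q 0 Qin (sub0 algA).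
move=> x Ax; have [_ ->] := pi_sum Q x Qin Ax.
by rewrite Ql // (bc_lambda pi_iso) ?mul1r //; apply: (subalg1 algA).
Qed.

End BasicConstruction.

(** * Towers of finite index and their rotations *)

(* [N n], [E n], [e n] are the paper's A_(n-1), E_n, e_(n+1), so that the inclusion
   B <= A is [N 0 `<=` N 1].  A quasi-basis is a sequence of pairs [p] with
   [x = \sum p.1 * E n (p.2 * x)]; [p.2] need not be [star p.1]. *)
Record index_tower (R : realType) (M : cstarType R) (N : nat -> set M)
    (E : nat -> M -> M) (e : nat -> M) (tau : R[i]) (q : nat -> seq (M * M)) :
    Prop := IndexTower {
  itw_alg : forall n, cstar_subalg (N n);
  itw_sub : forall n, N n `<=` N n.+1;
  itw_exp : forall n, cond_exp (N n.+1) (N n) (E n);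
  itw_e : forall n, N n.+2 (e n);
  itw_star : forall n, star (e n) = e n;
  itw_eE : forall n x, N n.+1 x -> e n * x * e n = E n x * e n;
  itw_dual : forall n x y, N n.+1 x -> N n.+1 y ->
    E n.+1 (x * e n * y) = tau *: (x * y);
  itw_span : forall n d, N n.+2 d ->
    exists2 s : seq (M * M), {in s, forall p, N n.+1 p.1 /\ N n.+1 p.2}
      & d = \sum_(p <- s) p.1 * e n * p.2;
  itw_qb_in : forall n, {in q n, forall p, N n.+1 p.1 /\ N n.+1 p.2};
  itw_qbl : forall n x, N n.+1 x -> \sum_(p <- q n) p.1 * E n (p.2 * x) = x;
  itw_qbr : forall n x, N n.+1 x -> \sum_(p <- q n) E n (x * p.1) * p.2 = x;
  itw_qb1 : forall n, \sum_(p <- q n) p.1 * e n * p.2 = 1;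
  itw_qS : forall n,
    q n.+1 = [seq (tau^-1 *: (p.1 * e n), e n * p.2) | p <- q n];
  itw_min0 : forall y, relcomm (N 0%N) (N 1%N) y ->
    tau *: \sum_(p <- q 0%N) p.1 * y * p.2 = E 0%N y;
  itw_center0 : forall x, relcomm (N 0%N) (N 0%N) x -> exists a : R[i], x = a *: 1;
  itw_center1 : forall x, relcomm (N 1%N) (N 1%N) x -> exists a : R[i], x = a *: 1;
  itw_tau0 : tau != 0;
  itw_tauC : Num.conj tau = tau }.

Section Tower.
Variables (R : realType) (M : cstarType R) (N : nat -> set M).
Variables (E : nat -> M -> M) (e : nat -> M) (tau : R[i]).
Variable q : nat -> seq (M * M).
Hypothesis H : index_tower N E e tau q.
Implicit Types (x y z : M) (n m s k : nat).

Lemma N1 n : N n 1. Proof. exact: subalg1 (itw_alg H n). Qed.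
Lemma N0 n : N n 0. Proof. exact: sub0 (itw_alg H n). Qed.
Lemma NM n x y : N n x -> N n y -> N n (x * y).
Proof. exact: subalgM (itw_alg H n) x y. Qed.
Lemma ND n x y : N n x -> N n y -> N n (x + y).
Proof. exact: subD (itw_alg H n) x y. Qed.
Lemma NB n x y : N n x -> N n y -> N n (x - y).
Proof. exact: subB (itw_alg H n) x y. Qed.
Lemma NN n x : N n x -> N n (- x).
Proof. exact: subN (itw_alg H n) x. Qed.
Lemma NZ n (a : R[i]) x : N n x -> N n (a *: x).
Proof. exact: subZ (itw_alg H n) a x. Qed.
Lemma Nstar n x : N n x -> N n (star x).
Proof. exact: subalg_star (itw_alg H n) x. Qed.
Lemma Nmono n m x : (n <= m)%N -> N n x -> N m x.
Proof.
move=> /subnK <-; elim: (m - n)%N => [//|k ih] /ih; exact: itw_sub H _ _.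
Qed.
Lemma Ne n m : (n.+2 <= m)%N -> N m (e n).
Proof. by move=> /Nmono; apply; exact: itw_e H n. Qed.
Lemma NE n m x : (n <= m)%N -> N n.+1 x -> N m (E n x).
Proof. by move=> /Nmono h Nx; apply: h; apply: (cexp_in (itw_exp H n)). Qed.
Lemma N_sum n (I : eqType) (r : seq I) (F : I -> M) :
  {in r, forall i, N n (F i)} -> N n (\sum_(i <- r) F i).
Proof. exact: (sub_sum (itw_alg H n)). Qed.
Lemma Nq1 n m p : p \in q n -> (n < m)%N -> N m p.1.
Proof. by move=> /(itw_qb_in H) [h _] /Nmono; apply. Qed.
Lemma Nq2 n m p : p \in q n -> (n < m)%N -> N m p.2.
Proof. by move=> /(itw_qb_in H) [_ h] /Nmono; apply. Qed.

Ltac mem := lazymatch goal with |- N _ _ =>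
  solve [repeat first
    [ assumption
    | match goal with h : N ?k ?x |- N ?m ?x => apply: (@Nmono k m x _ h); lia end
    | exact: N1 | exact: N0
    | (apply: Ne; lia)
    | match goal with h : is_true (?p \in q ?n) |- N ?m ?p.1 =>
        apply: (Nq1 h); lia end
    | match goal with h : is_true (?p \in q ?n) |- N ?m ?p.2 =>
        apply: (Nq2 h); lia end
    | apply: NM | apply: NB | apply: ND | apply: NN | apply: NZ | apply: Nstar
    | (apply: NE; [lia|])
    | (apply: N_sum => ? ?) ] ] end.

Lemma E_D n x y : N n.+1 x -> N n.+1 y -> E n (x + y) = E n x + E n y.
Proof. exact: cexpD (itw_exp H n) x y. Qed.
Lemma E_B n x y : N n.+1 x -> N n.+1 y -> E n (x - y) = E n x - E n y.
Proof. exact: (cexpB (itw_alg H n.+1) (itw_alg H n) (itw_exp H n)) x y. Qed.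
Lemma E_Z n (a : R[i]) x : N n.+1 x -> E n (a *: x) = a *: E n x.
Proof. exact: (cexpZ (itw_alg H n.+1) (itw_alg H n) (itw_exp H n)) a x. Qed.
Lemma E_id n x : N n x -> E n x = x.
Proof. exact: (cexp_id (itw_exp H n)) x. Qed.
Lemma E_sum n (I : eqType) (r : seq I) (F : I -> M) :
  {in r, forall i, N n.+1 (F i)} ->
  E n (\sum_(i <- r) F i) = \sum_(i <- r) E n (F i).
Proof. exact: (cexp_sum (itw_alg H n.+1) (itw_alg H n) (itw_exp H n)). Qed.
Lemma E_Ml n b x : N n b -> N n.+1 x -> E n (b * x) = b * E n x.
Proof. exact: (cexpMl (itw_alg H n) (itw_exp H n)). Qed.
Lemma E_Mr n x b : N n.+1 x -> N n b -> E n (x * b) = E n x * b.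
Proof. exact: (cexpMr (itw_alg H n) (itw_exp H n)). Qed.
Lemma E_star n x : N n.+1 x -> E n (star x) = star (E n x).
Proof. exact: (cexp_star (itw_alg H n.+1) (itw_alg H n) (itw_exp H n)). Qed.

Lemma dual_l n x : N n.+1 x -> E n.+1 (x * e n) = tau *: x.
Proof. by move=> Nx; rewrite -[_ * e n]mulr1 (itw_dual H) ?mulr1 //; mem. Qed.

Lemma tau_inj : injective (fun x : M => tau *: x).
Proof. exact: scalerI (itw_tau0 H). Qed.

Lemma starZtau x : star (tau *: x) = tau *: star x.
Proof. by rewrite starZ (itw_tauC H). Qed.

Lemma e_idem n : e n * e n = e n.
Proof.
have := itw_eE H (N1 n.+1); rewrite mulr1 E_id ?mul1r //; exact: N1.
Qed.

(** The hypothesis forces [x * e n = 0] by the C*-identity, and the next expectation sends [x * e n]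
    to [tau *: x]. *)
Lemma E_faithful n x : N n.+1 x -> E n (star x * x) = 0 -> x = 0.
Proof.
move=> Nx h; apply: tau_inj; rewrite -(dual_l Nx) scaler0.
suff -> : x * e n = 0 by rewrite E_id //; mem.
apply: star_mul_eq0; rewrite starM (itw_star H) mulrA -[e n * _ * _]mulrA.
by rewrite (itw_eE H) ?h ?mul0r //; mem.
Qed.

Lemma e_comm n x : N n x -> e n * x = x * e n.
Proof.
have h y : N n y -> e n * y * e n = y * e n.
  by move=> Ny; rewrite (itw_eE H) ?E_id //; mem.
move=> Nx; rewrite -h //; have := congr1 (@star _ _) (h _ (Nstar Nx)).
by rewrite !starM starK (itw_star H) mulrA.
Qed.

Lemma e_comm_e (i j : nat) : (i.+2 <= j)%N -> e j * e i = e i * e j.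
Proof. by move=> ij; apply: e_comm; mem. Qed.

Lemma E_e n : E n.+1 (e n) = tau *: 1.
Proof. by have := dual_l (N1 n.+1); rewrite mul1r. Qed.

Lemma eSe n : e n.+1 * e n * e n.+1 = tau *: e n.+1.
Proof. by rewrite (itw_eE H) ?E_e ?mulr_algl //; mem. Qed.

(** Unlike [eSe], this Temperley-Lieb relation is not an instance of [itw_eE]. The defect [d] is
    self-adjoint with [d * d = - (tau *: d)] and zero expectation, so faithfulness kills it. *)
Lemma eeS n : e n * e n.+1 * e n = tau *: e n.
Proof.
apply/eqP; rewrite -subr_eq0; apply/eqP/(@E_faithful n.+2); first by mem.
set d := _ - _; have sd : star d = d.
  by rewrite starB !starM !(itw_star H) mulrA starZtau (itw_star H).
have Ed : E n.+2 d = 0.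
  rewrite E_B ?(itw_dual H) ?e_idem ?E_id ?subrr //; by mem.
have de : d * e n = d.
  by rewrite /d mulrBl -scalerAl e_idem; congr (_ - _); rewrite -[LHS]mulrA e_idem.
have dd : d * d = - (tau *: d).
  rewrite {2}/d mulrBr -scalerAr de !mulrA de -[RHS]add0r; congr (_ - _).
  rewrite /d !mulrBl -!scalerAl -[e n * e n.+1 * e n * e n.+1]mulrA.
  by rewrite -[_ * (_ * _)]mulrA [e n.+1 * _]mulrA eSe -scalerAr -scalerAl subrr.
by rewrite sd dd -scaleNr E_Z ?Ed ?scaler0 //; mem.
Qed.

Lemma span_ind n (P : M -> Prop) : P 0 ->
  (forall x y, N n.+2 x -> N n.+2 y -> P x -> P y -> P (x + y)) ->
  (forall a b, N n.+1 a -> N n.+1 b -> P (a * e n * b)) ->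
  forall d, N n.+2 d -> P d.
Proof.
move=> P0 PD PM d /(itw_span H) [s sN ->].
suff [] : N n.+2 (\sum_(p <- s) p.1 * e n * p.2) /\ P (\sum_(p <- s) p.1 * e n * p.2) by [].
rewrite big_seq; elim/big_ind: _ => [|x y [Nx Px] [Ny Py]|p /sN [? ?]].
- by split => //; mem.
- by split; [mem|apply: PD].
- by split; [mem|apply: PM].
Qed.

Lemma pull n y : N n.+2 y ->
  exists2 a, N n.+1 a & y * e n = a * e n.
Proof.
move: y; apply: span_ind.
- by exists 0; rewrite ?mul0r //; mem.
- move=> x y _ _ [a Na ha] [b Nb hb]; exists (a + b); first by mem.
  by rewrite !mulrDl ha hb.
- move=> a b Na Nb; exists (a * E n b); first by mem.
  by rewrite -!mulrA [e n * _]mulrA (itw_eE H) // mulrA.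
Qed.

Lemma e_unit n y : y * e n = 0 -> (forall b, N n.+1 b -> y * b = b * y) -> y = 0.
Proof.
move=> ye yc; rewrite -[y]mulr1 -(itw_qb1 H n) mulr_sumr big_seq big1 // => p pq.
rewrite !mulrA yc -?[p.1 * y * _]mulrA ?ye ?mulr0 ?mul0r //; mem.
Qed.

Lemma e_unit_l n y : (forall b, N n.+1 b -> y * b * e n = 0) -> y = 0.
Proof.
move=> ye; rewrite -[y]mulr1 -(itw_qb1 H n) mulr_sumr big_seq big1 // => p pq.
by rewrite !mulrA ye ?mul0r //; mem.
Qed.

Lemma e_mul_inj n a b : N n.+1 a -> N n.+1 b -> a * e n = b * e n -> a = b.
Proof.
by move=> Na Nb h; apply: tau_inj; rewrite /= -(dual_l Na) h dual_l.
Qed.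

(** A central [x] of [N n.+2] is pushed down to an [E n a] central in [N n], and [itw_qb1] lets
    [e n] be cancelled. The induction therefore goes by steps of two, from the base cases [B] and
    [A]. *)
Lemma tower_center n x : relcomm (N n) (N n) x -> exists a : R[i], x = a *: 1.
Proof.
suff [] : (forall x, relcomm (N n) (N n) x -> exists a : R[i], x = a *: 1) /\
  (forall x, relcomm (N n.+1) (N n.+1) x -> exists a : R[i], x = a *: 1).
  by move=> h _; apply: h.
elim: n {x} => [|n [ih ih1]].
  by split; [exact: itw_center0 H|exact: itw_center1 H].
split=> // x [Nx cx]; have [a Na xa] := pull Nx.
have xb : x * e n = E n a * e n.
  rewrite -(itw_eE H) // -mulrA -xa mulrA -cx; last by mem.
  by rewrite -mulrA e_idem.
have [|b bE] := ih (E n a).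
  split=> [|c Nc]; first by mem.
  apply: (@e_mul_inj n); try mem.
  rewrite -!mulrA -e_comm // -xb mulrA -xb -!mulrA e_comm // !mulrA cx //; mem.
exists b; apply/eqP; rewrite -subr_eq0; apply/eqP/(@e_unit n).
  by rewrite mulrBl xb bE subrr.
move=> c Nc; rewrite mulrBl mulrBr cx; last by mem.
by rewrite -scalerAl -scalerAr mul1r mulr1.
Qed.

(** Minimality is given at the bottom only. Pushing [y] down along [e n] gives an [a] commuting with
    [N n], whose identity at level [n] yields [E n.+1 y = E n a]; the quasi-basis of level [n.+1]
    contains [e n], which reduces the sum to [E n a] again. *)
Lemma tower_min n y : relcomm (N n) (N n.+1) y ->
  tau *: \sum_(p <- q n) p.1 * y * p.2 = E n y.
Proof.
elim: n y => [|n ih] y; first exact: itw_min0 H y.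
move=> [Ny cy]; have [a Na ya] := pull Ny.
have Ba : relcomm (N n) (N n.+1) a.
  split=> // c Nc; apply: (@e_mul_inj n); try mem.
  rewrite -!mulrA -e_comm // mulrA -ya -mulrA e_comm // mulrA cy; last by mem.
  by rewrite -mulrA ya.
have Ey : E n.+1 y = E n a.
  rewrite -(ih a Ba) scaler_sumr -[y in LHS]mulr1 -(itw_qb1 H n) mulr_sumr.
  rewrite E_sum; last by move=> p pq; mem.
  apply: eq_big_seq => p pq.
  rewrite !mulrA cy; last by mem.
  by rewrite -[p.1 * y * _]mulrA ya mulrA (itw_dual H) //; mem.
have Ec c : N n.+1 c -> E n.+1 y * c = c * E n.+1 y.
  by move=> Nc; rewrite -E_Mr -?E_Ml ?cy //; mem.
rewrite (itw_qS H) big_map scaler_sumr -[RHS]mulr1 -(itw_qb1 H n) mulr_sumr.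
apply: eq_big_seq => p pq /=.
rewrite -!scalerAl scalerA mulfV ?(itw_tau0 H) // scale1r !mulrA Ec; last by mem.
rewrite Ey -[p.1 * e n * y * e n]mulrA ya -[p.1 * e n * _]mulrA [e n * (a * _)]mulrA.
by rewrite (itw_eE H) // mulrA.
Qed.

(** On a spanning product [a * e n * b] both sides equal [tau] times [E n a * E n b]. It makes the
    composites cyclic for Jones projections, hence for [up] and [rect]. *)
Lemma cyc_base n z : N n.+2 z ->
  E n (E n.+1 (e n * z)) = E n (E n.+1 (z * e n)).
Proof.
move: z; apply: span_ind.
- by rewrite mul0r mulr0.
- by move=> x y Nx Ny hx hy; rewrite mulrDr mulrDl !E_D ?hx ?hy //; mem.
- move=> a b Na Nb; rewrite !mulrA (itw_eE H) // -[a * e n * b * e n]mulrA.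
  rewrite -[a * e n * _]mulrA [e n * _]mulrA (itw_eE H) // mulrA.
  have NEa : N n (E n a) by mem.
  have NEb : N n (E n b) by mem.
  rewrite dual_l; last by mem.
  rewrite (itw_dual H); try mem.
  rewrite !E_Z; try mem.
  by rewrite (E_Ml NEa Nb) (E_Mr Na NEb).
Qed.

(** * Composites of the expectations *)

Fixpoint Phi s k : M -> M := if k is j.+1 then Phi s j \o E (s + j) else id.

Lemma PhiS s k x : Phi s k.+1 x = Phi s k (E (s + k) x). Proof. by []. Qed.

Lemma Phi_catS s k x : Phi s k.+1 x = E s (Phi s.+1 k x).
Proof.
elim: k x => [|k ih] x; first by rewrite /= addn0.
by rewrite PhiS ih PhiS addnS.
Qed.

Lemma Phi_cat s j k x : Phi s (j + k) x = Phi s j (Phi (s + j) k x).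
Proof.
elim: k x => [|k ih] x; first by rewrite addn0.
by rewrite addnS !PhiS ih addnA.
Qed.

Lemma NPhi s k m x : (s <= m)%N -> N (s + k) x -> N m (Phi s k x).
Proof.
move=> sm; elim: k x => [|k ih] x; first by rewrite addn0 => /(Nmono sm).
by rewrite addnS PhiS => Nx; apply: ih; mem.
Qed.

Lemma Phi_id s k x : N s x -> Phi s k x = x.
Proof.
by move=> Nx; elim: k => [//|k ih]; rewrite PhiS E_id //; mem.
Qed.

Lemma PhiD s k x y : N (s + k) x -> N (s + k) y ->
  Phi s k (x + y) = Phi s k x + Phi s k y.
Proof.
elim: k x y => [//|k ih] x y; rewrite addnS !PhiS => Nx Ny.
by rewrite E_D // ih //; mem.
Qed.

Lemma PhiZ s k (a : R[i]) x : N (s + k) x -> Phi s k (a *: x) = a *: Phi s k x.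
Proof.
elim: k x => [//|k ih] x; rewrite addnS !PhiS => Nx.
by rewrite E_Z // ih //; mem.
Qed.

Lemma PhiB s k x y : N (s + k) x -> N (s + k) y ->
  Phi s k (x - y) = Phi s k x - Phi s k y.
Proof.
by move=> Nx Ny; rewrite -(scaleN1r y) PhiD ?PhiZ ?scaleN1r //; mem.
Qed.

Lemma Phi_sum s k (I : eqType) (r : seq I) (F : I -> M) :
  {in r, forall i, N (s + k) (F i)} ->
  Phi s k (\sum_(i <- r) F i) = \sum_(i <- r) Phi s k (F i).
Proof.
elim: k F => [//|k ih] F; rewrite addnS PhiS => NF.
rewrite E_sum // ih //; by move=> i /NF Ni; mem.
Qed.

Lemma Phi_Ml s k b x : N s b -> N (s + k) x -> Phi s k (b * x) = b * Phi s k x.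
Proof.
move=> Nb; elim: k x => [//|k ih] x; rewrite addnS !PhiS => Nx.
by rewrite E_Ml ?ih //; mem.
Qed.

Lemma Phi_Mr s k x b : N s b -> N (s + k) x -> Phi s k (x * b) = Phi s k x * b.
Proof.
move=> Nb; elim: k x => [//|k ih] x; rewrite addnS !PhiS => Nx.
by rewrite E_Mr ?ih //; mem.
Qed.

Lemma Phi_star s k x : N (s + k) x -> Phi s k (star x) = star (Phi s k x).
Proof.
elim: k x => [//|k ih] x; rewrite addnS !PhiS => Nx.
by rewrite E_star ?ih //; mem.
Qed.

Lemma Phi_faithful s k x : N (s + k) x -> Phi s k (star x * x) = 0 -> x = 0.
Proof.
elim: k x => [|k ih] x; first by move=> _ /star_mul_eq0.
rewrite addnS PhiS => Nx; have [y Ny yE] := cexp_ge0 (itw_exp H _) Nx.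
rewrite yE => /(ih _ Ny) y0; apply: (E_faithful Nx).
by rewrite yE y0 mulr0.
Qed.

Lemma Phi_cyc s k j z : (s <= j)%N -> (j.+2 <= s + k)%N -> N (s + k) z ->
  Phi s k (e j * z) = Phi s k (z * e j).
Proof.
elim: k z => [|k ih] z sj jk Nz; first by lia.
rewrite !PhiS; rewrite addnS in Nz.
have [jk'|jk'] := leqP j.+2 (s + k).
  by rewrite E_Ml ?E_Mr ?ih //; mem.
case: k {ih} jk jk' Nz => [|k] jk jk' Nz; first by lia.
have -> : j = (s + k)%N by lia.
by rewrite !PhiS addnS cyc_base //; mem.
Qed.

(** * Staggered products of Jones projections *)

Lemma comm_eA (i j : nat) x : (i.+2 <= j)%N -> x * e j * e i = x * e i * e j.
Proof. by move=> ij; rewrite -!mulrA e_comm_e. Qed.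
Lemma eSeA x n : x * e n.+1 * e n * e n.+1 = tau *: (x * e n.+1).
Proof. by rewrite -!mulrA [e n.+1 * _]mulrA eSe scalerAr. Qed.
Lemma eeSA x n : x * e n * e n.+1 * e n = tau *: (x * e n).
Proof. by rewrite -!mulrA [e n * _]mulrA eeS scalerAr. Qed.

Fixpoint up s k : M := if k is j.+1 then e s * up s.+1 j else 1.
Fixpoint dn s k : M := if k is j.+1 then e (s + j) * dn s j else 1.

(* The product of j staggered rows; the last row is e_s ... e_(s+k-1), and each
   row is shifted by one from the next. *)
Fixpoint rect s j k : M := if j is i.+1 then rect s.+1 i k * up s k else 1.

Lemma up_r s k : up s k.+1 = up s k * e (s + k).
Proof.
elim: k s => [|k ih] s; first by rewrite /= addn0 mul1r mulr1.
by rewrite [LHS]/= -/(up _ k.+1) ih mulrA addSnnS.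
Qed.

Lemma dn_r s k : dn s k.+1 = dn s.+1 k * e s.
Proof.
elim: k => [|k ih]; first by rewrite /= addn0 mul1r mulr1.
by rewrite [LHS]/= -/(dn _ k.+1) ih mulrA /= addSnnS.
Qed.

Lemma star_up s k : star (up s k) = dn s k.
Proof.
elim: k s => [|k ih] s; first exact: star1.
by rewrite dn_r /= starM (itw_star H) ih.
Qed.

Lemma star_dn s k : star (dn s k) = up s k.
Proof. by rewrite -star_up starK. Qed.

Lemma Nup s k m : (s + k < m)%N -> N m (up s k).
Proof.
by elim: k s => [|k ih] s sm /=; [mem|apply: NM; [mem|apply: ih; lia]].
Qed.

Lemma Ndn s k m : (s + k < m)%N -> N m (dn s k).
Proof.
by elim: k => [|k ih] sm /=; [mem|apply: NM; [mem|apply: ih; lia]].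
Qed.

Lemma Nrect s j k m : (s + j + k <= m)%N -> N m (rect s j k).
Proof.
elim: j s => [|j ih] s sm /=; first by mem.
by apply: NM; [apply: ih; lia|apply: Nup; lia].
Qed.

Lemma comm_up s k x : N s x -> up s k * x = x * up s k.
Proof.
elim: k s => [|k ih] s Nx /=; first by rewrite mulr1 mul1r.
by rewrite -mulrA ih ?mulrA ?e_comm //; mem.
Qed.

Lemma comm_dn s k x : N s x -> dn s k * x = x * dn s k.
Proof.
elim: k => [|k ih] Nx /=; first by rewrite mulr1 mul1r.
by rewrite -mulrA ih ?mulrA ?e_comm //; mem.
Qed.

Lemma comm_rect s j k x : N s x -> rect s j k * x = x * rect s j k.
Proof.
elim: j s => [|j ih] s Nx /=; first by rewrite mulr1 mul1r.
by rewrite -mulrA comm_up ?mulrA ?ih //; mem.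
Qed.

Ltac memw := lazymatch goal with |- N _ _ => solve [repeat first [ mem
  | (apply: Nup; lia) | (apply: Ndn; lia) | (apply: Nrect; lia)
  | match goal with |- N _ (Phi _ _ _) => apply: NPhi; [lia|] end
  | apply: NM | apply: NB | apply: ND | apply: NN | apply: NZ | apply: Nstar
  | (apply: NE; [lia|]) ]] end.

Lemma rect_l s j k : rect s j.+1 k = up (s + j) k * rect s j k.
Proof.
elim: j s => [|j ih] s; first by rewrite /= addn0 mul1r mulr1.
by rewrite [LHS]/= -/(rect s.+1 j.+1 k) ih /= -addSnnS mulrA.
Qed.

Lemma rect_colr s j k : rect s j k.+1 = rect s j k * dn (s + k) j.
Proof.
elim: j s => [|j ih] s; first by rewrite /= mulr1.
rewrite [LHS]/= -/(up s k.+1) ih up_r dn_r addSn /= mulrA.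
by rewrite -!mulrA [dn _ j * _]mulrA comm_dn ?mulrA //; memw.
Qed.

Lemma rect_coll s j k : rect s j k.+1 = dn s j * rect s.+1 j k.
Proof.
elim: j s => [|j ih] s; first by rewrite /= mulr1.
rewrite [LHS]/= ih dn_r /= !mulrA; congr (_ * _).
by rewrite -!mulrA comm_rect //; memw.
Qed.

Lemma star_rect s j k : star (rect s j k) = rect s k j.
Proof.
elim: k s => [|k ih] s.
  elim: j s => [|j ihj] s; first exact: star1.
  by rewrite /= mulr1 ihj.
by rewrite rect_coll starM ih star_dn.
Qed.

Lemma rect0 s j : rect s j 0 = 1.
Proof. by elim: j s => [//|j ih] s; rewrite /= ih mulr1. Qed.

Lemma rect_split s j k l : rect s j (k + l) = rect s j k * rect (s + k) j l.
Proof.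
elim: l => [|l ih]; first by rewrite rect0 addn0 mulr1.
by rewrite addnS !rect_colr ih mulrA addnA.
Qed.

(** [e_(c+2) e_c e_(c+1) e_(c+2)] and [e_c e_(c+1) e_c e_(c+2)] are both [tau e_c e_(c+2)]. For
    larger [i] the generator first commutes past the head of the row. *)
Lemma up_shift c i k : (i.+2 < k)%N -> e (c + i.+2) * up c k = up c k * e (c + i).
Proof.
elim: i c k => [|i ih] c [|[|[|k]]] //= ik; rewrite ?addn0 ?addn2.
  rewrite !mulrA e_comm_e // eSeA.
  have -> : e c * e c.+1 * e c.+2 * up c.+3 k * e c = e c * e c.+1 * e c * (e c.+2 * up c.+3 k).
    rewrite -!mulrA; congr (_ * (_ * _)); rewrite !mulrA -e_comm_e // -!mulrA; congr (_ * _).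
    by rewrite comm_up //; mem.
  by rewrite eeS !mulrA -!scalerAl.
have := ih c.+1 k.+2 (ltnSE ik) => /= h.
have -> : (c + i.+1 = c.+1 + i)%N by lia.
rewrite mulrA e_comm_e; last by lia.
have -> : (c + i.+3 = c.+1 + i.+2)%N by lia.
by rewrite -[LHS]mulrA h mulrA.
Qed.

Lemma rect_top s j k : e (s + j) * rect s j.+1 k.+1 = rect s j.+1 k.+1.
Proof. by rewrite rect_l /= !mulrA e_idem. Qed.

(** Mirror symmetry about [s + j]. Crossing a row lowers the index by two and the centre by one, so
    the distance to the centre drops by one; at distance 1 both sides collapse by the Temperley-Lieb
    relations. *)
Lemma rect_flip s i j k : (0 < i <= j)%N -> (i < k)%N ->
  e (s + j + i) * rect s j.+1 k = e (s + j - i) * rect s j.+1 k.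
Proof.
elim: i j => [//|[_|i ih]] [//|j] /andP[_ ij] ik.
  case: k ik => [|[|k]] // _; rewrite !rect_l [rect s j _]lock /=.
  have -> : (s + j.+1 = (s + j).+1)%N by lia.
  rewrite subn1 addn1 /=; set d := (s + j)%N.
  set X := up d.+3 k; set Y := up d.+2 k; set V := locked _.
  have cX z : z * X * e d = z * e d * X by rewrite -!mulrA comm_up //; mem.
  rewrite !mulrA eSe !cX comm_eA // eeS -!scalerAl; congr (_ *: _).
  by rewrite e_comm_e.
rewrite rect_l mulrA.
rewrite up_shift // -[LHS]mulrA.
have -> : (s + j.+1 + i = s + j + i.+1)%N by lia.
rewrite ih; [|lia|lia].
have -> : (s + j - i.+1 = s + j.+1 - i.+2)%N by lia.
by rewrite !mulrA comm_up //; mem.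
Qed.

Lemma rect_flip_up s p m : (m <= p)%N ->
  up (s + p).+1 m * rect s p.+1 p.+1 = up (s + p - m) m * rect s p.+1 p.+1.
Proof.
elim: m => [//|m ih] mp; rewrite up_r -mulrA.
have -> : ((s + p).+1 + m = s + p + m.+1)%N by lia.
rewrite rect_flip; [|lia|lia].
rewrite mulrA comm_up; last by mem.
rewrite -mulrA ih; last by lia.
by rewrite mulrA /=; have -> : (s + p - m = (s + p - m.+1).+1)%N by lia.
Qed.

Lemma rect_flip_dn s p m : (m <= p)%N ->
  dn (s + p - m) m * rect s p.+1 p.+1 = dn (s + p).+1 m * rect s p.+1 p.+1.
Proof.
elim: m => [//|m ih] mp; rewrite dn_r -mulrA -rect_flip; [|lia|lia].
have -> : ((s + p - m.+1).+1 = s + p - m)%N by lia.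
rewrite mulrA -e_comm; last by memw.
have -> : (s + p + m.+1 = (s + p).+1 + m)%N by lia.
by rewrite -mulrA ih ?mulrA //; lia.
Qed.

Lemma dn_up s m : dn s m.+1 * up s.+1 m = tau ^+ m *: e (s + m).
Proof.
elim: m => [|m ih]; first by rewrite /= addn0 !mulr1 scale1r.
rewrite [dn s m.+2]/= -/(dn s m.+1) up_r mulrA -[_ * dn _ _ * _]mulrA ih.
by rewrite -scalerAr -scalerAl addSn addnS eSe scalerA exprSr.
Qed.

Lemma up_dn s m : up s m.+1 * dn s m = tau ^+ m *: e s.
Proof.
elim: m => [|m ih]; first by rewrite /= !mulr1 scale1r.
rewrite up_r up_r [dn s m.+1]/= addnS !mulrA eeSA -!scalerAl -up_r ih.
by rewrite scalerA exprS.
Qed.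

(** These words remain in [E_rect] beside the inner rectangle once the topmost generator is gone;
    the mirror image of [up] cancels against [dn]. *)
Lemma rect_sandwich s p :
  up (s + p) p * dn s p * rect s.+1 p p = tau ^+ p *: rect s.+1 p p.
Proof.
case: p => [|p]; first by rewrite /= !mul1r scale1r.
set g := rect _ _ _; rewrite [up _ _]/= -mulrA -[e _ * _ * _]mulrA.
rewrite [up _ _ * (_ * _)]mulrA comm_up; last by memw.
have -> : ((s + p.+1).+1 = (s.+1 + p).+1)%N by lia.
rewrite -mulrA rect_flip_up // addnK [dn s p.+1 * _]mulrA dn_up -scalerAl -scalerAr.
have -> : (s + p.+1 = s.+1 + p)%N by lia.
have -> : e (s.+1 + p) * (e (s + p) * g) = tau *: g.
  have gE : e (s + p).+1 * g = g := rect_top s.+1 p p.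
  by move: gE; move: (g) => h hE; rewrite -{1}hE !mulrA addSn eSe -scalerAl hE.
by rewrite scalerA exprSr.
Qed.

Lemma E_rect s p :
  E (s + p + p).+1 (rect s p.+1 p.+1) = tau ^+ p.+1 *: rect s.+1 p p.
Proof.
rewrite rect_l rect_coll up_r (itw_dual H); try memw.
by rewrite mulrA rect_sandwich scalerA exprS.
Qed.

(** The successive expectations contribute [tau] to the powers [p, ..., 1], by [E_rect]. *)
Lemma Phi_rect s p : Phi (s + p) p (rect s p p) = tau ^+ 'C(p.+1, 2) *: 1.
Proof.
elim: p s => [|p ih] s; first by rewrite /= scale1r.
rewrite PhiS; have -> : (s + p.+1 + p = (s + p + p).+1)%N by lia.
rewrite E_rect; have -> : (s + p.+1 = s.+1 + p)%N by lia.
rewrite PhiZ; last by memw.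
by rewrite ih scalerA -exprD addnC [in RHS]binS bin1.
Qed.

(* [rect s p p] is a multiple of the Jones projection of [N s `<=` N (s + p)], and
   this lets [N (s + 2 p)] act on [N (s + p)]. *)
Lemma rect_absorb s p y b : N (s + p + p) y -> N (s + p) b ->
  exists2 a, N (s + p) a & y * b * rect s p p = a * rect s p p.
Proof.
case: p => [|p].
  by rewrite !addn0 => Ny Nb; exists (y * b) => //; mem.
set f := rect _ _ _; set c := (s + p)%N.
have fE : e c * f = f := rect_top s p p.
have ff i : (0 < i <= p)%N -> e (c + i) * f = e (c - i) * f.
  by move=> ip; apply: rect_flip; [|lia].
clearbody f.
have -> : (s + p.+1 = c.+1)%N by rewrite addnS.
(* In climbing by one algebra, the new generator [e (c + i)] is replaced on [f] by its mirror image
   [e (c - i)], which lies in [N c.+1]; the central one, [i = 0], is absorbed by [f] and produces an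
   expectation. *)
suff h i : (i <= p.+1)%N -> forall y, N (c.+1 + i) y -> forall b, N c.+1 b ->
    exists2 a, N c.+1 a & y * b * f = a * f.
  by move=> Ny Nb; apply: (h p.+1).
elim: i => [|i ih] ip {}y.
  by rewrite addn0 => Ny {}b Nb; exists (y * b) => //; mem.
rewrite addnS addSn; move: y; apply: span_ind.
- by move=> {}b Nb; exists 0; rewrite ?mul0r //; mem.
- move=> x y _ _ hx hy {}b Nb; have [a Na ha] := hx b Nb; have [a' Na' ha'] := hy b Nb.
  by exists (a + a'); [mem|rewrite !mulrDl ha ha'].
move=> x y Nx Ny {}b Nb.
have [a Na ha] := ih (ltnW ip) y Ny b Nb.
rewrite -[x * _ * y * b]mulrA -mulrA ha.
suff [d Nd hd] : exists2 d, N c.+1 d & e (c + i) * (a * f) = d * f.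
  rewrite -[x * _ * _]mulrA hd mulrA; exact: ih (ltnW ip) x Nx d Nd.
case: i {ih Nx Ny} ip => [|i] ip.
  exists (E c a); first by mem.
  by rewrite addn0 -{1}fE !mulrA (itw_eE H) // -mulrA fE.
exists (a * e (c - i.+1)); first by mem.
rewrite mulrA e_comm; last by mem.
by rewrite -!mulrA ff //; lia.
Qed.

Lemma rect_absorb_r s p y b : N (s + p + p) y -> N (s + p) b ->
  exists2 a, N (s + p) a & rect s p p * b * y = rect s p p * a.
Proof.
move=> Ny Nb; have [a Na ha] := rect_absorb (Nstar Ny) (Nstar Nb).
exists (star a); first by mem.
by apply: (can_inj (@starK R M)); rewrite !starM star_rect starK mulrA ha.
Qed.

(** Induction on the rows. The top row turns [y * b] into [u * e (s + j + k)], and an expectation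
    transfers the hypothesis to [u]; [up_dn] then undoes the row and leaves
    [y * b * e (s + j) = 0]. *)
Lemma rect_inj s j k y : N (s + j + k) y ->
  (forall b, N (s + j) b -> y * b * rect s j k = 0) -> y = 0.
Proof.
elim: j y => [|j ih] y Ny h.
  by have := h 1 (N1 _); rewrite /= !mulr1.
case: k ih Ny h => [|k] ih Ny h.
  by have := h 1 (N1 _); rewrite rect0 !mulr1.
apply: (@e_unit_l (s + j)) => b Nb.
have hu : y * b * up (s + j) k.+1 = 0.
  have [|u Nu hu] := @pull (s + j + k) (y * b * up (s + j) k); first by memw.
  rewrite up_r mulrA hu.
  suff -> : u = 0 by rewrite mul0r.
  apply: ih => [|b' Nb']; first by memw.
  apply: tau_inj; rewrite /= scaler0 -mulrA -(itw_dual H (n := s + j + k)); try memw.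
  have bb : N (s + j.+1) (b * b') by memw.
  rewrite -hu -!mulrA [up _ _ * (e _ * _)]mulrA -up_r [up _ _ * (b' * _)]mulrA comm_up //.
  by rewrite -[b' * _ * _]mulrA -rect_l [b * _]mulrA mulrA h // E_id //; mem.
have := congr1 (fun z => z * dn (s + j) k) hu.
rewrite /= mul0r -mulrA -[e _ * _]/(up (s + j) k.+1) up_dn -scalerAr => /eqP.
by rewrite scaler_eq0 expf_eq0 (negPf (itw_tau0 H)) andbF /= => /eqP.
Qed.

(** * Relative commutants and quasi-bases of composites *)

Lemma boxPhi a b k x : (a <= b)%N -> relcomm (N a) (N (b + k)) x ->
  relcomm (N a) (N b) (Phi b k x).
Proof.
move=> ab [Nx cx]; split=> [|c Nc]; first by memw.
by rewrite -Phi_Mr -?Phi_Ml ?cx //; mem.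
Qed.

Lemma boxE a n x : (a <= n)%N -> relcomm (N a) (N n.+1) x ->
  relcomm (N a) (N n) (E n x).
Proof.
move=> an [Nx cx]; split=> [|c Nc]; first by mem.
by rewrite -E_Mr -?E_Ml ?cx //; mem.
Qed.

Lemma boxM a m x y : relcomm (N a) (N m) x -> relcomm (N a) (N m) y ->
  relcomm (N a) (N m) (x * y).
Proof.
move=> [Nx cx] [Ny cy]; split=> [|c Nc]; first by mem.
by rewrite -mulrA cy // mulrA cx // mulrA.
Qed.

Lemma box_star a m x : relcomm (N a) (N m) x -> relcomm (N a) (N m) (star x).
Proof.
move=> [Nx cx]; split=> [|c Nc]; first by mem.
by rewrite -[c]starK -!starM cx //; mem.
Qed.

Lemma boxD a m x y : relcomm (N a) (N m) x -> relcomm (N a) (N m) y ->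
  relcomm (N a) (N m) (x + y).
Proof.
move=> [Nx cx] [Ny cy]; split=> [|c Nc]; first by mem.
by rewrite mulrDl mulrDr cx ?cy.
Qed.

Lemma boxZ a m (t : R[i]) x : relcomm (N a) (N m) x -> relcomm (N a) (N m) (t *: x).
Proof.
move=> [Nx cx]; split=> [|c Nc]; first by mem.
by rewrite -scalerAl cx ?scalerAr.
Qed.

Lemma boxB a m x y : relcomm (N a) (N m) x -> relcomm (N a) (N m) y ->
  relcomm (N a) (N m) (x - y).
Proof. by move=> Nx Ny; rewrite -(scaleN1r y); apply: boxD => //; apply: boxZ. Qed.

Lemma box1 a m : relcomm (N a) (N m) 1.
Proof. by split=> [|c Nc]; [mem|rewrite mulr1 mul1r]. Qed.

Lemma box_anti a b m x : (a <= b)%N -> relcomm (N b) (N m) x ->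
  relcomm (N a) (N m) x.
Proof. by move=> ab [Nx cx]; split=> // c Nc; apply: cx; mem. Qed.

Definition qbasis s k (Q : seq (M * M)) : Prop :=
  [/\ {in Q, forall p, N (s + k) p.1 /\ N (s + k) p.2},
      forall x, N (s + k) x -> \sum_(p <- Q) p.1 * Phi s k (p.2 * x) = x
    & forall x, N (s + k) x -> \sum_(p <- Q) Phi s k (x * p.1) * p.2 = x].

Lemma qbasis_comm s k m Q y : (s + k <= m)%N -> qbasis s k Q ->
  relcomm (N s) (N m) y ->
  relcomm (N (s + k)) (N m) (\sum_(p <- Q) p.1 * y * p.2).
Proof.
move=> skm [Qin Ql Qr] [Ny cy]; split=> [|a Na].
  by apply: N_sum => p /Qin [? ?]; mem.
apply: (@quasi_central R M (N (s + k)) (N s) (Phi s k)) => // [x z|x] *; last exact: NPhi.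
exact: NM.
Qed.

(** Products of the quasi-bases of successive steps. In the index identity the inner sum commutes
    with [N (s + k)] by [qbasis_comm], as [tower_min] requires. *)
Lemma qbasis_ex s k : exists2 Q, qbasis s k Q
  & forall y, relcomm (N s) (N (s + k)) y ->
    tau ^+ k *: \sum_(p <- Q) p.1 * y * p.2 = Phi s k y.
Proof.
elim: k => [|k [Q Qq Qmin]].
  exists [:: (1, 1)]; last first.
    by move=> y _; rewrite big_seq1 /= mul1r mulr1 scale1r.
  split=> [p|x _|x _]; rewrite ?big_seq1 /= ?mul1r ?mulr1 //.
  by rewrite inE => /eqP ->; split; mem.
have [Qin Ql Qr] := Qq.
exists [seq (p.1 * r.1, r.2 * p.2) | p <- q (s + k), r <- Q]; last first.
  move=> y By; have [Ny cy] := By.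
  have By' : relcomm (N s) (N (s + k).+1) y by rewrite -addnS.
  have h := qbasis_comm (leqnSn _) Qq By'.
  rewrite big_allpairs_dep exprS -scalerA scaler_sumr PhiS -Qmin; last first.
    by apply: boxE => //; lia.
  have -> : tau ^+ k *: \sum_(p <- Q) p.1 * E (s + k) y * p.2
     = E (s + k) (tau ^+ k *: \sum_(p <- Q) p.1 * y * p.2).
    rewrite E_Z ?E_sum; [|by move=> p /Qin [? ?]; mem|by case: h].
    congr (_ *: _); rewrite big_seq [RHS]big_seq; apply: eq_bigr => p /Qin [? ?].
    by rewrite E_Mr ?E_Ml //; mem.
  rewrite -(tower_min (boxZ _ h)); congr (_ *: _); apply: eq_bigr => p _.
  rewrite -scalerAr -scalerAl mulr_sumr mulr_suml; congr (_ *: _).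
  by apply: eq_bigr => r _; rewrite /= !mulrA.
split.
- move=> p /allpairsPdep [a [b [aq /Qin [? ?] ->]]] /=; rewrite addnS; split; mem.
- move=> x Nx; rewrite big_allpairs_dep -[RHS](itw_qbl H (n := s + k)); last by mem.
  rewrite big_seq [RHS]big_seq; apply: eq_bigr => p pq.
  rewrite -[E _ (p.2 * x)]Ql; last by mem.
  rewrite mulr_sumr big_seq [RHS]big_seq; apply: eq_bigr => r /Qin [? ?] /=.
  by rewrite -!mulrA E_Ml //; mem.
- move=> x Nx; rewrite big_allpairs_dep -[RHS](itw_qbr H (n := s + k)); last by mem.
  rewrite big_seq [RHS]big_seq; apply: eq_bigr => p pq.
  rewrite -[E _ (x * p.1)]Qr; last by mem.
  rewrite mulr_suml big_seq [RHS]big_seq; apply: eq_bigr => r /Qin [? ?] /=.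
  by rewrite !mulrA E_Mr //; mem.
Qed.

Lemma Phi_scalar s k x : relcomm (N s) (N (s + k)) x ->
  exists a : R[i], Phi s k x = a *: 1.
Proof. by move=> Bx; apply: tower_center (boxPhi (leqnn s) Bx). Qed.

Lemma Phi_self_scalar s k x : relcomm (N s) (N (s + k)) x -> star x = x ->
  exists t : R, Phi s k x = t%:C *: 1.
Proof.
move=> Bx sx; have [a aE] := Phi_scalar Bx.
have [|t tE] := @self_scale1 R M a; first by rewrite -aE -Phi_star ?sx //; case: Bx.
by exists t; rewrite aE tE.
Qed.

(* If the scalar [Phi (star x * x)] were negative, then so would be the least
   value of the real quadratic polynomial [Phi (star (r + x) * (r + x))] in [r],
   which then has a root; by faithfulness [x] is a scalar, a contradiction. *)
Lemma Phi_ge0 s k x : relcomm (N s) (N (s + k)) x ->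
  exists2 t : R, 0 <= t & Phi s k (star x * x) = t%:C *: 1.
Proof.
move=> Bx; have [Nx cx] := Bx; have Bsx := box_star Bx; have [Nsx csx] := Bsx.
have [|t tE] := Phi_self_scalar (boxM Bsx Bx); first by rewrite starM starK.
have [|b bE] := Phi_self_scalar (boxD Bx Bsx); first by rewrite starD starK addrC.
exists t => //; rewrite leNgt; apply/negP => t0.
pose d := Num.sqrt (b ^+ 2 / 4 - t).
have dE : d ^+ 2 = b ^+ 2 / 4 - t by rewrite sqr_sqrtr; nra.
pose r := d - b / 2.
have rE : r * r + r * b + t = 0 by rewrite /r; move: dE; rewrite !expr2; lra.
clearbody r.
pose w := r%:C *: 1 + x.
have w0 : w = 0.
  apply: (@Phi_faithful s k); first by mem.
  have -> : star w * w = (r * r)%:C *: 1 + r%:C *: (x + star x) + star x * x.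
    rewrite starD starZr star1 mulrDl !mulrDr -!scalerAl !mul1r -scalerAr mulr1.
    by rewrite scalerA -rmorphM scalerDr !addrA.
  rewrite PhiD; [|by mem|by mem]; rewrite PhiD; [|by mem|by mem].
  rewrite !PhiZ; [|by mem|by mem]; rewrite bE tE (Phi_id _ (N1 s)).
  rewrite scalerA -rmorphM -!scalerDl -!rmorphD /= rE; exact: scale0r.
have xE : x = (- r)%:C *: 1.
  by apply/eqP; rewrite rmorphN scaleNr -addr_eq0 addrC -/w w0.
have : t = r * r.
  have := tE; rewrite xE starZr star1 -scalerAl -scalerAr mulr1 scalerA -rmorphM.
  by rewrite PhiZ ?Phi_id ?mulrNN => [/scale1_inj/complexI ->||] //; mem.
by move=> tr; have := sqr_ge0 r; rewrite expr2 -tr leNgt t0.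
Qed.

(** * The modular automorphism and traciality *)

Section Modular.
Variables (s k : nat) (Q : seq (M * M)).
Hypothesis Qq : qbasis s k Q.
Hypothesis Qmin : forall y, relcomm (N s) (N (s + k)) y ->
  tau ^+ k *: \sum_(p <- Q) p.1 * y * p.2 = Phi s k y.

(* The modular automorphism: [Phi (z * sg y) = Phi (y * z)]. *)
Let sg y := \sum_(p <- Q) p.1 * Phi s k (y * p.2).

Let Qin : {in Q, forall p, N (s + k) p.1 /\ N (s + k) p.2}.
Proof. by case: Qq. Qed.

Let N_sg y : N (s + k) y -> N (s + k) (sg y).
Proof. by move=> Ny; apply: N_sum => p /Qin [? ?]; memw. Qed.

Let nondeg t : N (s + k) t -> (forall z, N (s + k) z -> Phi s k (z * t) = 0) -> t = 0.
Proof. by move=> Nt h; apply: (Phi_faithful Nt); apply: h; mem. Qed.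

Let nondeg_eq t t' : N (s + k) t -> N (s + k) t' ->
  (forall z, N (s + k) z -> Phi s k (z * t) = Phi s k (z * t')) -> t = t'.
Proof.
move=> Nt Nt' h; apply/eqP; rewrite -subr_eq0; apply/eqP/nondeg; first by mem.
by move=> z Nz; rewrite mulrBr PhiB ?h ?subrr //; mem.
Qed.

Let sg_sum y a z : relcomm (N s) (N (s + k)) y -> N (s + k) a -> N (s + k) z ->
  Phi s k (z * \sum_(p <- Q) p.1 * Phi s k (y * p.2 * a)) = Phi s k (y * z * a).
Proof.
move=> [Ny cy] Na Nz; have [_ _ Qr] := Qq.
rewrite mulr_sumr Phi_sum; last by move=> p /Qin [? ?]; memw.
rewrite -{2}(Qr z) // mulr_sumr mulr_suml Phi_sum; last by move=> p /Qin [? ?]; memw.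
apply: eq_big_seq => p /Qin [? ?].
rewrite mulrA Phi_Mr; try memw.
rewrite -Phi_Ml; try memw.
by rewrite !mulrA cy //; memw.
Qed.

Let sgP y z : relcomm (N s) (N (s + k)) y -> N (s + k) z ->
  Phi s k (z * sg y) = Phi s k (y * z).
Proof.
move=> By Nz; rewrite -[y * z]mulr1 -sg_sum //; last by mem.
by congr (Phi _ _ (_ * _)); apply: eq_bigr => p _; rewrite mulr1.
Qed.

Let sg_box y : relcomm (N s) (N (s + k)) y -> relcomm (N s) (N (s + k)) (sg y).
Proof.
move=> By; have [Ny cy] := By; have Nsg := N_sg Ny; split=> // c Nc.
apply: nondeg_eq; try mem.
move=> z Nz; rewrite mulrA Phi_Mr; try mem.
rewrite [z * (c * _)]mulrA sgP // [RHS]sgP //; last by mem.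
by rewrite mulrA [RHS]Phi_Mr //; mem.
Qed.

(** Minimality acts here: [Qmin] writes [Phi (x * y)] as a sum over [Q], and re-expanding [y * p.2]
    moves [y] to the left of [x] in the form [sg y]. *)
Let sg_swap x y : relcomm (N s) (N (s + k)) x -> relcomm (N s) (N (s + k)) y ->
  Phi s k (x * y) = Phi s k (sg y * x).
Proof.
move=> Bx By; have [Nx cx] := Bx; have [Ny cy] := By; have Nsg := N_sg Ny.
have [_ _ Qr] := Qq.
rewrite -!Qmin; [|by apply: boxM => //; apply: sg_box|exact: boxM].
congr (_ *: _).
have -> : \sum_(p <- Q) p.1 * (x * y) * p.2
   = \sum_(p <- Q) \sum_(r <- Q) p.1 * Phi s k (y * p.2 * r.1) * x * r.2.
  apply: eq_big_seq => p /Qin [? ?].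
  rewrite mulrA -[p.1 * x * y * _]mulrA -{1}(Qr (y * p.2)); last by mem.
  rewrite mulr_sumr; apply: eq_big_seq => r /Qin [? ?].
  by rewrite mulrA -[p.1 * x * _]mulrA cx ?mulrA //; memw.
rewrite exchange_big; apply: eq_big_seq => r /Qin [? ?].
rewrite -!mulr_suml; congr (_ * _); rewrite mulrA; congr (_ * _).
apply: nondeg_eq; try memw.
  by apply: N_sum => p /Qin [? ?]; memw.
move=> z Nz; rewrite sg_sum // mulrA sgP //; last by mem.
by rewrite mulrA.
Qed.

(** [sgP] and [sg_swap] give [Phi (y * z) = Phi (z * sg y) = Phi (sg (sg y) * z)]; taking
    [z = star w] for the difference [w] suffices by faithfulness. *)
Let sgK y : relcomm (N s) (N (s + k)) y -> sg (sg y) = y.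
Proof.
move=> By; have Bsg := sg_box By; have Bsgg := sg_box Bsg.
apply/eqP; rewrite -subr_eq0; apply/eqP; rewrite -[LHS]starK.
have := boxB Bsgg By; set w := _ - _ => Bw; have [Nw _] := Bw.
have Bsw := box_star Bw; have [Nsw _] := Bsw.
suff -> : star w = 0 by rewrite star0.
apply: (@Phi_faithful s k) => //; rewrite starK.
have [Ny _] := By; have [Nsg _] := Bsg; have [Nsgg _] := Bsgg.
rewrite {1}/w mulrBl PhiB; try mem.
by rewrite -sg_swap // sgP // subrr.
Qed.

(* By [sgK], [w = sg y - y] satisfies [sg w = - w], so [Phi (star w * w)] is minus
   [Phi (w * star w)]; both being nonnegative scalars, they vanish. *)
Lemma modular_trivial y z : relcomm (N s) (N (s + k)) y -> N (s + k) z ->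
  Phi s k (y * z) = Phi s k (z * y).
Proof.
move=> By Nz; rewrite -sgP //; congr (Phi _ _ (_ * _)).
have Bsg := sg_box By; have [Ny _] := By; have [Nsg _] := Bsg.
apply/eqP; rewrite -subr_eq0; apply/eqP.
have := boxB Bsg By; set w := _ - _ => Bw; have [Nw _] := Bw.
have Bsw := box_star Bw; have [Nsw _] := Bsw.
have sgw : sg w = - w.
  rewrite opprB -[X in X - _](sgK By) -sumrB; apply: eq_big_seq => p /Qin [? ?].
  by rewrite -mulrBr -PhiB ?mulrBl //; mem.
apply: (@Phi_faithful s k) => //.
have := sgP Bw Nsw; rewrite sgw mulrN -scaleN1r PhiZ ?scaleN1r; last by mem.
have [t t0 ->] := Phi_ge0 Bw; have [t' t'0] := Phi_ge0 Bsw; rewrite starK => ->.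
rewrite -scaleNr -rmorphN => /scale1_inj/complexI tt'.
have -> : t = 0 by move: t0 t'0 tt'; lra.
by rewrite scale0r.
Qed.

End Modular.

Lemma Phi_tracial s k x z : relcomm (N s) (N (s + k)) x -> N (s + k) z ->
  Phi s k (x * z) = Phi s k (z * x).
Proof. by have [Q Qq Qmin] := qbasis_ex s k; exact: (modular_trivial Qq Qmin). Qed.

(** The trace-preserving expectation onto the commutant of [N s.+1]: [tr_cond_expE] identifies it
    for [s = 0], and [Phi_theta] is its invariance. *)
Definition theta s y := tau *: \sum_(p <- q s) p.1 * y * p.2.

Lemma qbasis_q s : qbasis s 1 (q s).
Proof.
rewrite /qbasis addn1 /= addn0.
by split; [exact: itw_qb_in H s|exact: itw_qbl H s|exact: itw_qbr H s].
Qed.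

Lemma theta_box s m y : (s < m)%N -> relcomm (N s) (N m) y ->
  relcomm (N s.+1) (N m) (theta s y).
Proof.
move=> sm By; apply: boxZ; have := @qbasis_comm s 1 m (q s) y.
by rewrite addn1; apply=> //; apply: qbasis_q.
Qed.

(** * Fourier transforms and rotations *)

Section Rotation.
Variables (k k' : nat).
Hypothesis kE : k = k'.+1.

Let up_kl s : up s k = e s * up s.+1 k'. Proof. by rewrite kE. Qed.
Let up_kr s : up s k = up s k' * e (s + k'). Proof. by rewrite kE up_r. Qed.
Let dn_kl s : dn s k = e (s + k') * dn s k'. Proof. by rewrite kE. Qed.
Let dn_kr s : dn s k = dn s.+1 k' * e s. Proof. by rewrite kE dn_r. Qed.
Let skE s : (s + k = (s + k').+1)%N. Proof. by rewrite kE addnS. Qed.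

(* For [s = 0], [Fr], [Fi] and [rho] are the Fourier transform, its inverse and
   rho^+ on B' `&` A_(k-1), freed of the powers of [tau ^ (1/2)]; for general [s]
   they are those of the tower which starts at [N s].  [rhom] is rho^-. *)
Definition Fr s x := tau ^- k *: theta s (x * dn s k).
Definition Fi s w := tau^-1 *: E (s + k) (w * up s k).
Definition Kr s w := star (Fi s (star w)).
Definition Lr s x := star (Fr s (star x)).
Definition rho s x := Kr s (Fr s x).
Definition rhom s w := Lr s (Fi s w).

Definition box s := relcomm (N s) (N (s + k)).
Definition box' s := relcomm (N s.+1) (N (s.+1 + k)).

Let xk : tau ^+ k != 0.
Proof. by rewrite expf_neq0 // (itw_tau0 H). Qed.

Lemma box_dn s x : box s x -> relcomm (N s) (N (s + k).+1) (x * dn s k).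
Proof.
move=> [Nx cx]; split=> [|c Nc]; first by memw.
by rewrite -mulrA comm_dn // !mulrA cx.
Qed.

Lemma Fr_box s x : box s x -> box' s (Fr s x).
Proof.
move=> Bx; apply: boxZ; rewrite addSn; apply: theta_box; first by lia.
exact: box_dn.
Qed.

Lemma Fi_box s w : box' s w -> box s (Fi s w).
Proof.
move=> [Nw cw]; rewrite addSn in Nw; apply: boxZ.
apply: boxE; first by lia.
split=> [|c Nc]; first by memw.
by rewrite -mulrA comm_up // !mulrA cw //; mem.
Qed.

Lemma Kr_box s w : box' s w -> box s (Kr s w).
Proof. by move=> Bw; apply/box_star/Fi_box/box_star. Qed.

Lemma Lr_box s x : box s x -> box' s (Lr s x).
Proof. by move=> Bw; apply/box_star/Fr_box/box_star. Qed.

(** [dn s k] ends and [up s k] begins with [e s], so each [p.2] between them becomes [E s p.2],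
    which moves to the left; the quasi-basis then resums to 1, and [dn_up] is left. *)
Lemma Fr_up s x : box s x -> Fr s x * up s k = x * e (s + k').
Proof.
move=> [Nx cx].
have key c : N s.+1 c ->
    x * dn s k * c * up s k = E s c * (x * dn s k * up s.+1 k').
  move=> Nc; rewrite dn_kr up_kl [x * (_ * e s)]mulrA; set y := x * _.
  have cy : y * E s c = E s c * y.
    by rewrite /y -mulrA comm_dn ?mulrA ?cx //; mem.
  clearbody y; rewrite !mulrA -[y * e s * c]mulrA -[y * (e s * c) * e s]mulrA.
  by rewrite (itw_eE H) // !mulrA cy.
rewrite /Fr /theta -!scalerAl mulr_suml.
have -> : \sum_(p <- q s) p.1 * (x * dn s k) * p.2 * up s k
    = (\sum_(p <- q s) p.1 * E s (p.2 * 1)) * (x * dn s k * up s.+1 k').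
  rewrite mulr_suml; apply: eq_big_seq => p pq; rewrite mulr1.
  rewrite -[p.1 * _ * p.2]mulrA -[LHS]mulrA key; last by mem.
  by rewrite [LHS]mulrA.
rewrite (itw_qbl H (N1 _)) mul1r -mulrA kE dn_up -scalerAr !scalerA.
by rewrite -mulrA -exprS mulVf ?scale1r // -kE.
Qed.

Lemma FiK s x : box s x -> Fi s (Fr s x) = x.
Proof.
move=> Bx; have [Nx _] := Bx; rewrite /Fi Fr_up // skE dual_l; last by mem.
by rewrite scalerA mulVf ?scale1r ?(itw_tau0 H).
Qed.

(** Pushed down, [w * up s k] is [a * e (s + k')], with expectation [tau *: a]. Once [a = 0],
    [up_dn] recovers [w * e s = 0], and [w] commutes with [N s.+1]. *)
Lemma Fi_inj s w : box' s w -> Fi s w = 0 -> w = 0.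
Proof.
move=> [Nw cw] /eqP; rewrite scaler_eq0 invr_eq0 (negPf (itw_tau0 H)) /= => /eqP.
have [|a Na aE] := @pull (s + k') (w * up s k'); first by memw.
have wu : w * up s k = a * e (s + k') by rewrite up_kr mulrA.
rewrite wu skE dual_l // => /eqP.
rewrite scaler_eq0 (negPf (itw_tau0 H)) /= => /eqP a0.
have : w * up s k * dn s k' = 0 by rewrite wu a0 !mul0r.
rewrite -mulrA kE up_dn -scalerAr => /eqP.
rewrite scaler_eq0 expf_eq0 (negPf (itw_tau0 H)) andbF /= => /eqP we.
by apply: e_unit we _.
Qed.

Lemma FiB s w w' : box' s w -> box' s w' -> Fi s (w - w') = Fi s w - Fi s w'.
Proof.
move=> [Nw _] [Nw' _]; rewrite addSn in Nw Nw'.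
by rewrite /Fi mulrBl E_B ?scalerBr //; memw.
Qed.

Lemma Fi_eq s w w' : box' s w -> box' s w' -> Fi s w = Fi s w' -> w = w'.
Proof.
move=> Bw Bw' h; apply/eqP; rewrite -subr_eq0; apply/eqP/(@Fi_inj s); first exact: boxB.
by rewrite FiB // h subrr.
Qed.

Lemma FrK s w : box' s w -> Fr s (Fi s w) = w.
Proof.
move=> Bw; have Bi := Fi_box Bw; apply: (@Fi_eq s) => //; first exact: Fr_box.
by rewrite FiK.
Qed.

Lemma KrK s w : box' s w -> Lr s (Kr s w) = w.
Proof. by move=> Bw; rewrite /Lr /Kr starK FrK ?starK //; apply: box_star. Qed.

Lemma KrE s w : box' s w -> Kr s w = tau^-1 *: E (s + k) (dn s k * w).
Proof.
move=> [Nw _]; rewrite addSn in Nw; rewrite /Kr /Fi starZ.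
have -> : Num.conj tau^-1 = tau^-1 by rewrite fmorphV; congr (_^-1); exact: itw_tauC H.
by rewrite -E_star; [rewrite starM starK star_up|memw].
Qed.

(* One further click commutes with the rotation: this is what identifies
   [Fr s (Kr s _)], the inverse of the lower rotation, with the rotation of the
   shifted tower. *)
Lemma Fr_Kr s w : box' s w -> Fr s (Kr s w) = Kr s.+1 (Fr s.+1 w).
Proof.
move=> Bw; have Bw1 : box s.+1 w by [].
have BF := Fr_box Bw1; have [NF cF] := BF; have [Nw cw] := Bw.
apply: (@Fi_eq s); [exact/Fr_box/Kr_box|exact: Kr_box BF|].
rewrite FiK; last exact: Kr_box.
rewrite (KrE Bw) (KrE BF) /Fi; congr (_ *: _).
set u := Fr s.+1 w in BF NF cF *; set n := (s + k)%N.
rewrite -[(s.+1 + k)%N]/n.+1; rewrite -[(s.+1 + k)%N]/n.+1 in Nw.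
rewrite -[(s.+2 + k)%N]/n.+2 in NF.
have Nd : N n.+2 (dn s.+1 k * u * up s k) by rewrite /n; memw.
have Ndw : N n.+1 (dn s k * w) by rewrite /n; memw.
rewrite -scalerAl E_Z; last by rewrite /n; memw.
rewrite -E_Mr; try by rewrite /n; memw.
suff -> : E n (E n.+1 (dn s.+1 k * u * up s k)) = tau *: E n (dn s k * w).
  by rewrite scalerA mulVf ?scale1r ?(itw_tau0 H).
(* Splitting off [e n] allows [cyc_base] twice: on the right it completes the product that [Fr_up]
   evaluates, and when moved back it is absorbed by another copy of itself. *)
have top : e n * dn s.+1 k = dn s.+1 k by rewrite dn_kl addSn -skE mulrA e_idem.
rewrite -top -!mulrA cyc_base; last by rewrite mulrA.
have -> : dn s.+1 k * (u * up s k) * e n = e n * (dn s k * w * e n).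
  rewrite up_kl mulrA [u * (_ * _)]mulrA cF; last by rewrite /n; memw.
  rewrite -!mulrA -[n]/(s + k)%N [in e (s + k)]skE -addSn -up_kr [_ * (e s * _)]mulrA.
  rewrite Fr_up // addSn -skE !mulrA; congr (_ * _ * _).
  by rewrite dn_kl addSn -skE -mulrA -dn_kr.
rewrite cyc_base; last by rewrite /n; memw.
by rewrite -mulrA e_idem dual_l // E_Z // /n; memw.
Qed.

Lemma rho_box s x : box s x -> box s (rho s x).
Proof. by move=> Bx; apply/Kr_box/Fr_box. Qed.

Lemma iter_rho_box j s x : box s x -> box s (iter j (rho s) x).
Proof. by move=> Bx; elim: j => [//|j ih]; apply: rho_box. Qed.

Lemma Fr_iter_rho j s x : box s x ->
  Fr s (iter j (rho s) x) = iter j (rho s.+1) (Fr s x).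
Proof.
move=> Bx; elim: j => [//|j ih]; rewrite !iterS -ih /rho Fr_Kr //.
exact/Fr_box/iter_rho_box.
Qed.

(** [w] is the [j]-fold Fourier transform of [x] through the towers that start at [s], [s + 1], and
    so on. By [Fr_iter_rho] the clicks are made in the next tower, and inverting one transform adds
    one row to [rect]. *)
Lemma rho_chain j s x : box s x ->
  exists2 w, relcomm (N (s + j)) (N (s + j + k)) w &
    x = tau ^- j *: Phi (s + k) j (w * rect s j k) /\
    iter j (rho s) x = tau ^- j *: Phi (s + k) j (star (rect s j k) * w).
Proof.
elim: j s x => [|j ih] s x Bx.
  exists x; first by rewrite addn0.
  by rewrite /= mulr1 star1 mul1r expr0 invr1 scale1r.
have BF := Fr_box Bx; have [w Bw [e1 e2]] := ih s.+1 (Fr s x) BF.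
rewrite addSnnS in Bw; exists w => //.
have [Nw cw] := Bw.
have tjS z : tau ^- j.+1 *: z = tau^-1 *: (tau ^- j *: z).
  by rewrite scalerA -invfM -exprS.
have NF : N (s + k).+1 (tau ^- j *: Phi (s + k).+1 j (w * rect s.+1 j k)) by memw.
rewrite !tjS !Phi_catS; split.
- rewrite -{1}(FiK Bx) e1 /Fi [rect s j.+1 k]/= mulrA.
  congr (_ *: _); rewrite -scalerAl -Phi_Mr; [|by memw|by memw].
  by rewrite E_Z //; memw.
- rewrite iterS /rho Fr_iter_rho // KrE ?e2; last by rewrite -e2; apply: iter_rho_box.
  rewrite [rect s j.+1 k]/= starM star_up -mulrA.
  congr (_ *: _); rewrite -scalerAr -Phi_Ml; [|by memw|by memw].
  by rewrite E_Z //; memw.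
Qed.
End Rotation.

Lemma Phi_cyc_up s m a k z : (s <= a)%N -> (a + k < s + m)%N -> N (s + m) z ->
  Phi s m (up a k * z) = Phi s m (z * up a k).
Proof.
elim: k a z => [|k ih] a z sa am Nz; first by rewrite /= mulr1 mul1r.
rewrite /= -mulrA Phi_cyc; [|lia|lia|by memw].
by rewrite -mulrA ih ?mulrA //; [lia|lia|memw].
Qed.

Lemma Phi_cyc_rect s m a j k z : (s <= a)%N -> (a + j + k <= s + m)%N ->
  N (s + m) z -> Phi s m (rect a j k * z) = Phi s m (z * rect a j k).
Proof.
elim: j a z => [|j ih] a z sa am Nz; first by rewrite /= mulr1 mul1r.
rewrite /= -mulrA ih; [|lia|lia|by memw].
by rewrite -mulrA Phi_cyc_up ?mulrA //; [lia|memw].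
Qed.

(** * The half turn as a transposition *)

Section HalfTurn.
Variables (s p : nat).
Hypothesis p0 : (0 < p)%N.
Let f := rect s p p.
Let alpha := tau ^+ 'C(p.+1, 2).

Let alpha0 : alpha != 0.
Proof. by rewrite expf_neq0 // (itw_tau0 H). Qed.

Let Nf m : (s + p + p <= m)%N -> N m f.
Proof. by move=> pm; apply: Nrect. Qed.

Let Phi_f : Phi (s + p) p f = alpha *: 1.
Proof. exact: Phi_rect. Qed.

Let Phi_fl a : N (s + p) a -> Phi (s + p) p (a * f) = alpha *: a.
Proof. by move=> Na; rewrite Phi_Ml ?Phi_f -?scalerAr ?mulr1 //; apply: Nf. Qed.

Let Phi_fr a : N (s + p) a -> Phi (s + p) p (f * a) = alpha *: a.
Proof. by move=> Na; rewrite Phi_Mr ?Phi_f -?scalerAl ?mul1r //; apply: Nf. Qed.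

(* Identifying [b] with [b * f], [N (s + 2 p)] acts on [N (s + p)] from the left,
   and from the right through [f * b].  [turns x y] says that [y] acts from the
   left as [x] does from the right, i.e. as the transpose of [x] for the bilinear
   form [Phi (a * b)]. *)
Definition turns x y : Prop := forall b, N (s + p) b ->
  exists2 a, N (s + p) a & y * b * f = a * f /\ f * b * x = f * a.

Let Nsp x : N (s + (p + p)) x -> N (s + p + p) x.
Proof. by rewrite addnA. Qed.

Lemma turns_uniq x y y' : N (s + (p + p)) y -> N (s + (p + p)) y' ->
  turns x y -> turns x y' -> y = y'.
Proof.
move=> Ny Ny' xy xy'; apply/eqP; rewrite -subr_eq0; apply/eqP.
apply: (@rect_inj s p p) => [|b Nb]; first by mem.
have [a Na [h1 h2]] := xy b Nb; have [a' Na' [h1' h2']] := xy' b Nb.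
have aa : a = a' by apply: (scalerI alpha0); rewrite -!Phi_fr // -h2 -h2'.
by rewrite !mulrBl -/f h1 h1' aa subrr.
Qed.

Lemma turns1 : turns 1 1.
Proof. by move=> b Nb; exists b; rewrite ?mul1r ?mulr1. Qed.

Lemma turnsL (c : R[i]) x x' y y' : turns x y -> turns x' y' ->
  turns (c *: x + x') (c *: y + y').
Proof.
move=> xy xy' b Nb; have [a Na [h1 h2]] := xy b Nb.
have [a' Na' [h1' h2']] := xy' b Nb.
exists (c *: a + a'); first by mem.
by rewrite !mulrDl mulrDr mulrDr -!scalerAl -!scalerAr h1 h2 h1' h2'.
Qed.

Lemma turnsM x x' y y' : turns x y -> turns x' y' -> turns (x * x') (y' * y).
Proof.
move=> xy xy' b Nb; have [a Na [h1 h2]] := xy b Nb.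
have [a' Na' [h1' h2']] := xy' a Na.
exists a' => //; split; last by rewrite mulrA h2.
by rewrite -[y' * y * b]mulrA -mulrA h1 mulrA.
Qed.

Lemma turns_star x y : turns x y -> turns (star y) (star x).
Proof.
move=> xy b Nb; have [|a Na [h1 h2]] := xy (star b); first by mem.
have sf : star f = f by rewrite star_rect.
exists (star a); first by mem.
split; apply: (can_inj (@starK R M)).
  by rewrite !starM !starK sf mulrA h2.
by rewrite !starM !starK sf mulrA h1.
Qed.

Let Phi_sand u v : N (s + p) u -> N (s + p) v ->
  Phi s (p + p) (u * f * v) = alpha *: Phi s p (u * v).
Proof.
move=> Nu Nv; rewrite Phi_cat Phi_Mr ?Phi_fl -?scalerAl ?PhiZ //; first by mem.
by apply: NM; [mem|apply: Nf].
Qed.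

Lemma turns_sym x y : relcomm (N s) (N (s + (p + p))) x -> N (s + (p + p)) y ->
  turns x y -> turns y x.
Proof.
move=> Bx Ny xy b Nb; have [Nx cx] := Bx.
have Nf2 : N (s + (p + p)) f by apply: Nf; lia.
have [a1 Na1 h1] := rect_absorb (Nsp Nx) Nb.
have [a2 Na2 h2] := rect_absorb_r (Nsp Ny) Nb.
rewrite -/f in h1 h2; exists a1 => //; split => //; rewrite h2; congr (_ * _).
apply/eqP; rewrite -subr_eq0; apply/eqP; rewrite -[LHS]starK.
set w := _ - _; have Nw : N (s + p) w by mem.
suff -> : star w = 0 by rewrite star0.
apply: (@Phi_faithful s p); first by mem.
rewrite starK; move: (star w) (Nstar Nw) => d Nd.
rewrite /w mulrBl PhiB; [|by mem|by mem].
have [a Na [h3 h4]] := xy d Nd.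
apply: (scalerI alpha0); rewrite scaler0 scalerBr.
(* [x] is carried round by [Phi_tracial], and below [f] is by [Phi_cyc_rect]; both values become the
   pairing of [b] with [a]. *)
have -> : alpha *: Phi s p (a1 * d) = Phi s (p + p) (b * f * a).
  rewrite -Phi_sand // -h1 -!mulrA Phi_tracial //; last by mem.
  by rewrite -!mulrA [f * _]mulrA h4.
have -> : alpha *: Phi s p (a2 * d) = Phi s (p + p) (b * a * f).
  rewrite -[a2 * d]mul1r -Phi_sand; [|by mem|by mem].
  rewrite mul1r mulrA -h2 -!mulrA Phi_cyc_rect; [|lia|lia|by mem].
  by rewrite -!mulrA -h3 !mulrA.
by rewrite Phi_sand // -[b * a * f]mulr1 Phi_sand ?mulr1 ?subrr //; mem.
Qed.

(* [x] and its rotation are the partial traces of [w * f * f2] and [f2 * f * w],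
   for one [w] that commutes with [N (s + p)]. *)
Lemma half_turn x : relcomm (N s) (N (s + (p + p))) x ->
  turns x (iter p (rho (p + p) s) x).
Proof.
move=> Bx; have kE : (p + p = (p + p).-1.+1)%N by lia.
set x' := iter _ _ _.
have Bx' : relcomm (N s) (N (s + (p + p))) x' by exact: iter_rho_box kE _ _ _ Bx.
have [w Bw [xE x'E]] := rho_chain kE p Bx; rewrite -/x' in x'E.
have [Nw cw] := Bw; have [Nx _] := Bx; have [Nx' _] := Bx'.
set f2 := rect (s + p) p p.
have rE : rect s p (p + p) = f * f2 by rewrite rect_split.
have rsE : star (rect s p (p + p)) = f2 * f.
  by rewrite rE starM /f2 /f !star_rect.
have Nf2 : N (s + p + (p + p)) f2 by apply: Nrect; lia.
have Nf' : N (s + (p + p)) f by apply: Nf; lia.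
move=> b Nb.
have [a Na h1] := rect_absorb (Nsp Nx') Nb.
have [a' Na' h2] := rect_absorb_r (Nsp Nx) Nb.
exists a => //; split => //; rewrite h2; congr (_ * _).
apply: (scalerI alpha0); rewrite -(Phi_fr Na') -(Phi_fl Na) -/f -h1 -h2.
rewrite -/f x'E {1}xE rsE rE -!scalerAl -!scalerAr.
rewrite !PhiZ; [congr (_ *: _)|by memw|by memw].
have -> : Phi (s + (p + p)) p (f2 * f * w) * b * f
    = Phi (s + p + p) p (f2 * (f * w * b * f)).
  rewrite -addnA -mulrA -Phi_Mr; [by rewrite !mulrA|by mem|by memw].
have -> : f * b * Phi (s + (p + p)) p (w * (f * f2))
    = Phi (s + p + p) p (f * b * w * f * f2).
  rewrite -addnA -Phi_Ml; [by rewrite !mulrA|by mem|by memw].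
rewrite -!Phi_cat -[f * w * b]mulrA cw // [RHS]Phi_cyc_rect; [by rewrite !mulrA|by []|lia|].
by mem.
Qed.

Lemma half_turn_box x : relcomm (N s) (N (s + (p + p))) x ->
  relcomm (N s) (N (s + (p + p))) (iter p (rho (p + p) s) x).
Proof. by move=> Bx; apply: (@iter_rho_box _ (p + p).-1 _ _ s x Bx); lia. Qed.

End HalfTurn.

(** * Invariance of the trace, and the reflections *)

Lemma Phi_theta s j m y : relcomm (N (s + j)) (N (s + (j + m.+1))) y ->
  Phi s (j + m.+1) (theta (s + j) y) = Phi s (j + m.+1) y.
Proof.
rewrite !Phi_cat addnA => By; congr Phi; set a := (s + j)%N in By *.
have [Ny cy] := By; rewrite !Phi_catS; have By' : relcomm (N a) (N a.+1) (Phi a.+1 m y).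
  by apply: boxPhi => //; rewrite addSnnS.
rewrite -[RHS](@E_id a); last by case: By' => ? _; mem.
rewrite -(tower_min By') -/(theta a _); congr (E a _).
rewrite /theta PhiZ; last by memw.
rewrite Phi_sum; last by move=> p pq; memw.
congr (_ *: _); apply: eq_big_seq => p pq.
by rewrite Phi_Mr ?Phi_Ml //; memw.
Qed.

(** Averaging by [theta] does not change the value; [u] and [z] let the quasi-basis through, and
    [itw_qb1] collapses the sum around [e (s + j)] to 1. *)
Lemma Phi_drop_e s j m u z : (j.+2 <= m)%N ->
  relcomm (N (s + j).+1) (N (s + m)) u -> relcomm (N (s + j).+1) (N (s + m)) z ->
  Phi s m (u * e (s + j) * z) = tau *: Phi s m (u * z).
Proof.
move=> jm [Nu cu] [Nz cz]; have mE : m = (j + (m - j).-1.+1)%N by lia.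
have By : relcomm (N (s + j)) (N (s + m)) (u * e (s + j) * z).
  split=> [|c Nc]; first by mem.
  rewrite -mulrA cz; last by mem.
  rewrite !mulrA; congr (_ * _); rewrite -mulrA e_comm // mulrA cu ?mulrA //; mem.
rewrite {1}mE -Phi_theta -?mE // -PhiZ; last by mem.
congr Phi; congr (_ *: _).
have -> : \sum_(p <- q (s + j)) p.1 * (u * e (s + j) * z) * p.2
    = u * (\sum_(p <- q (s + j)) p.1 * e (s + j) * p.2) * z.
  rewrite mulr_sumr mulr_suml; apply: eq_big_seq => p pq.
  rewrite -!mulrA cz; last by mem.
  by rewrite !mulrA cu //; mem.
by rewrite (itw_qb1 H) mulr1.
Qed.

(** The lowest generator occurs once and is dropped by [Phi_drop_e]; the words left beside the inner
    rectangle [g] then contract to a power of [tau]. For size [p.+2] the exponents [1], [p.+1] and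
    the inductive one add up to the binomial. *)
Lemma Phi_drop_rect s j p m u z : (0 < p)%N -> (j + p + p <= m)%N ->
  relcomm (N (s + j + p)) (N (s + m)) u -> relcomm (N (s + j + p)) (N (s + m)) z ->
  Phi s m (u * rect (s + j) p p * z) = tau ^+ 'C(p.+1, 2) *: Phi s m (u * z).
Proof.
elim: p j u z => [//|[|p] ih] j u z _ jm Bu Bz.
  rewrite /= mul1r !mulr1 expr1; apply: Phi_drop_e; [lia| |]; by rewrite -addn1.
have [Nu cu] := Bu; have [Nz cz] := Bz.
rewrite rect_l rect_coll dn_r; set a := (s + j)%N; set g := rect a.+1 p.+1 p.+1.
have Ng : N (s + m) g by apply: Nrect; lia.
have aE : (a.+1 = s + j.+1)%N by rewrite addnS.
have -> : u * (up (a + p.+1) p.+2 * (dn a.+1 p * e a * g)) * z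
     = (u * up (a + p.+1) p.+2 * dn a.+1 p) * e a * (g * z) by rewrite !mulrA.
rewrite Phi_drop_e; first last.
- split=> [|c Nc]; first by mem.
  rewrite -mulrA cz; last by mem.
  by rewrite mulrA comm_rect ?mulrA.
- split=> [|c Nc]; first by memw.
  rewrite -mulrA comm_dn // mulrA -[u * _ * c]mulrA comm_up; last by mem.
  by rewrite mulrA cu ?mulrA //; mem.
- lia.
have top : e (a.+1 + p) * g = g by exact: rect_top.
have gE : up (a + p.+1) p.+2 * dn a.+1 p * g = tau ^+ p.+1 *: g.
  have := @rect_flip_dn a.+1 p p (leqnn _); rewrite addnK -/g => h.
  rewrite -mulrA h [up _ _]/=.
  have -> : (a + p.+1 = a.+1 + p)%N by lia.
  rewrite -mulrA [up _ p.+1 * _]mulrA up_dn -scalerAl -scalerAr.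
  move: top; move: (g) => g0 g0E; rewrite -{1}g0E.
  by rewrite !mulrA eeS -!scalerAl g0E scalerA -exprSr.
have -> : u * up (a + p.+1) p.+2 * dn a.+1 p * (g * z) = tau ^+ p.+1 *: (u * g * z).
  rewrite scalerAl scalerAr -gE; move: (g) (up _ _) (dn _ _) => ? ? ?.
  by rewrite !mulrA.
rewrite PhiZ; last by mem.
rewrite /g aE ih //; [|lia| |]; last first.
- by have -> : (s + j.+1 + p.+1 = s + j + p.+2)%N by lia.
- by have -> : (s + j.+1 + p.+1 = s + j + p.+2)%N by lia.
rewrite !scalerA -exprS -exprD; congr (tau ^+ _ *: _).
by rewrite [in RHS]binS bin1 addnC.
Qed.

(** In both partial traces [f] stands between [w] and [f2], which commute with [N (s + p)]. Dropping
    [f] costs the same factor on both sides, and then [f2] is moved round cyclically. *)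
Lemma half_turn_Phi s p x : (0 < p)%N -> relcomm (N s) (N (s + (p + p))) x ->
  Phi s (p + p) (iter p (rho (p + p) s) x) = Phi s (p + p) x.
Proof.
move=> p0 Bx; have kE : (p + p = (p + p).-1.+1)%N by lia.
have [w Bw [xE x'E]] := rho_chain kE p Bx; have [Nw cw] := Bw.
set f := rect s p p; set f2 := rect (s + p) p p.
have rE : rect s p (p + p) = f * f2 by rewrite rect_split.
have rsE : star (rect s p (p + p)) = f2 * f.
  by rewrite rE starM /f2 /f !star_rect.
have Nf : N (s + (p + p) + p) f by apply: Nrect; lia.
have Nf2 : N (s + (p + p) + p) f2 by apply: Nrect; lia.
have Nw' : N (s + (p + p) + p) w by mem.
rewrite x'E {1}xE !PhiZ; [|by memw|by memw]; congr (_ *: _).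
rewrite -!Phi_cat rsE rE mulrA.
have Bf2 : relcomm (N (s + p)) (N (s + (p + p + p))) f2.
  by split=> [|c Nc]; [mem|rewrite comm_rect].
have Bw2 : relcomm (N (s + p)) (N (s + (p + p + p))) w.
  by split=> [|c Nc]; [mem|exact: cw].
have h u z : relcomm (N (s + p)) (N (s + (p + p + p))) u ->
    relcomm (N (s + p)) (N (s + (p + p + p))) z ->
    Phi s (p + p + p) (u * f * z) = tau ^+ 'C(p.+1, 2) *: Phi s (p + p + p) (u * z).
  move=> Bu Bz; have := @Phi_drop_rect s 0 p (p + p + p) u z p0.
  by rewrite addn0; apply=> //; lia.
by rewrite !h // Phi_cyc_rect //; [lia|lia|mem].
Qed.

(** As the transpose is unique, each algebraic clause is read off from a closure property of
    [turns]. *)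
Lemma half_turn_reflection s p : (0 < p)%N ->
  reflection_on (relcomm (N s) (N (s + (p + p)))) (Phi s (p + p))
    (iter p (rho (p + p) s)).
Proof.
move=> p0; set S := relcomm _ _; set r := iter _ _.
have Sr x : S x -> S (r x) by exact: half_turn_box.
have turn x : S x -> turns s p x (r x) by exact: half_turn.
have uniq x y : S x -> N (s + (p + p)) y -> turns s p x y -> r x = y.
  by move=> Sx Ny; apply: turns_uniq => //; [case: (Sr x Sx)|apply: turn].
have NS x : S x -> N (s + (p + p)) x by case.
have NSr x : S x -> N (s + (p + p)) (r x) by move=> /Sr /NS.
split=> //.
- move=> a x y Sx Sy; have ? := NSr x Sx; have ? := NSr y Sy; apply: uniq.
  + by apply: boxD => //; apply: boxZ.
  + by mem.
  + by apply: turnsL; apply: turn.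
- move=> x y Sx Sy; have ? := NSr x Sx; have ? := NSr y Sy; apply: uniq.
  + exact: boxM.
  + by mem.
  + by apply: turnsM; apply: turn.
- by apply: uniq; [apply: box1|mem|apply: turns1].
- move=> x Sx; apply: uniq; [exact: Sr|exact: NS|].
  by apply: turns_sym => //; [apply: NSr|apply: turn].
- move=> x Sx; have ? := NS x Sx; have ? := NSr x Sx; apply: uniq; [exact: box_star|by mem|].
  by apply: turns_sym => //; [apply/box_star/Sr|mem|apply/turns_star/turn].
- by move=> x Sx; apply: half_turn_Phi.
Qed.

Lemma rhomK k s w : (0 < k)%N -> relcomm (N s.+1) (N (s.+1 + k)) w ->
  rhom k s (rho k s.+1 w) = w.
Proof.
move=> k0 Bw; have kE : k = k.-1.+1 by rewrite prednK.
rewrite /rhom /rho -(Fr_Kr kE Bw) (FiK kE) ?(KrK kE) //.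
exact: Kr_box kE _ _ Bw.
Qed.

Lemma iter_rhom j k s w : (0 < k)%N -> relcomm (N s.+1) (N (s.+1 + k)) w ->
  iter j (rhom k s) (iter j (rho k s.+1) w) = w.
Proof.
move=> k0 Bw; elim: j => [//|j ih]; rewrite iterSr iterS rhomK //.
by apply: (@iter_rho_box _ k.-1 _ _ s.+1 w Bw); rewrite prednK.
Qed.

Lemma half_turn_rhom s p w : (0 < p)%N -> relcomm (N s.+1) (N (s.+1 + (p + p))) w ->
  iter p (rhom (p + p) s) w = iter p (rho (p + p) s.+1) w.
Proof.
move=> p0 Bw; have refl := half_turn_reflection s.+1 p0.
rewrite -{1}(reflK refl Bw) iter_rhom //; first by lia.
exact: (refl_in refl Bw).
Qed.

End Tower.

(** * The tower of a minimal conditional expectation *)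

Section JonesTower.
Variables (R : realType) (M : cstarType R) (T : jonesTower M).

Local Notation N := (jt_pred T).
Local Notation E := (jt_E T).
Local Notation e n := (jt_e T n.+1).
Local Notation tau := (((jt_index T)^-1)%:C).

Lemma tower_alg n : cstar_subalg (N n).
Proof. by case: n => [|n]; [exact: jt_subalgB|exact: jt_subalgA]. Qed.

Lemma tower_basic n : basic_construction (N n.+1) (E n) (N n.+2) (e n).
Proof. exact: jt_basic T n. Qed.

Lemma tower_sub n : N n `<=` N n.+1.
Proof. by case: n => [|n]; [exact: jt_sub|have [] := tower_basic n]. Qed.

Lemma tower_exp n : cond_exp (N n.+1) (N n) (E n).
Proof. exact: jt_cond_exp T n. Qed.

Lemma tau_neq0 : tau != 0.
Proof. by rewrite fmorph_eq0 invr_eq0 gt_eqF // jt_index_gt0. Qed.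

Section QuasiBasis.
Variable s : seq M.
Hypothesis qbs : quasi_basis (N 1%N) (E 0%N) s.

(** A quasi-basis of the dual expectation with adjoint factors would carry [tau^(-1/2)] in both;
    pairs allow [tau^-1] in the first alone. *)
Fixpoint tower_qb n : seq (M * M) :=
  if n is m.+1 then [seq (tau^-1 *: (p.1 * e m), e m * p.2) | p <- tower_qb m]
  else [seq (l, star l) | l <- s].

Lemma tower_qbP n :
  [/\ {in tower_qb n, forall p, N n.+1 p.1 /\ N n.+1 p.2},
      forall x, N n.+1 x -> \sum_(p <- tower_qb n) p.1 * E n (p.2 * x) = x
    & forall x, N n.+1 x -> \sum_(p <- tower_qb n) E n (x * p.1) * p.2 = x].
Proof.
elim: n => [|n [qin ql qr]].
  have [sA sE] := qbs; split.
  - move=> p /mapP [l ls ->]; split; first exact: sA.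
    by apply: (subalg_star (tower_alg 1)); apply: sA.
  - by move=> x /sE []; rewrite big_map => <-.
  - by move=> x /sE []; rewrite big_map => _ <-.
have [AD De DE _] := tower_basic n.
have [se eE e1] := basic_jones (tower_alg n.+1) (tower_alg n) (tower_alg n.+2)
  (tower_sub (n := n)) (tower_exp n) qin ql qr (tower_basic n).
have DM x y : N n.+2 x -> N n.+2 y -> N n.+2 (x * y) := subalgM (tower_alg _) (x := x) (y := y).
have AM x y : N n.+1 x -> N n.+1 y -> N n.+1 (x * y) := subalgM (tower_alg _) (x := x) (y := y).
have AE x : N n.+1 x -> N n.+1 (E n x).
  by move=> Ax; apply: tower_sub; apply: (cexp_in (tower_exp n)).
have eEc x : N n.+1 x -> e n * E n x = E n x * e n.
  move=> Ax; have Asx := subalg_star (tower_alg _) Ax.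
  have := congr1 (@star _ _) (eE _ Asx).
  rewrite (cexp_star (tower_alg _) (tower_alg _) (tower_exp n)) // !starM !starK se.
  by rewrite mulrA eE.
have dual x y : N n.+1 x -> N n.+1 y -> E n.+1 (x * e n * y) = tau *: (x * y).
  exact: jt_dual.
have cexpS := cexp_sum (tower_alg n.+2) (tower_alg n.+1) (tower_exp n.+1).
have cexpZ' := cexpZ (tower_alg n.+2) (tower_alg n.+1) (tower_exp n.+1).
split.
- move=> _ /mapP [p /qin [p1 p2] ->] /=; have Dp1 := AD _ p1; have Dp2 := AD _ p2.
  by split; [apply: (subZ (tower_alg n.+2))|]; apply: DM.
- move=> x; rewrite {1}DE => -[r rin xE]; rewrite big_map.
  have -> : \sum_(p <- tower_qb n) tau^-1 *: (p.1 * e n) * E n.+1 (e n * p.2 * x)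
    = \sum_(p <- tower_qb n) \sum_(z <- r) p.1 * E n (p.2 * z.1) * e n * z.2.
    apply: eq_big_seq => p /qin [p1 p2]; have Dp1 := AD _ p1; have Dp2 := AD _ p2.
    rewrite {1}xE mulr_sumr cexpS; last first.
      move=> z /rin [z1 z2]; have Dz1 := AD _ z1; have Dz2 := AD _ z2.
      by repeat first [assumption|apply: (DM)].
    rewrite mulr_sumr; apply: eq_big_seq => z /rin [z1 z2].
    have Apz := AM _ _ p2 z1.
    have -> : e n * p.2 * (z.1 * e n * z.2) = E n (p.2 * z.1) * e n * z.2.
      by rewrite -eE // !mulrA.
    rewrite dual //; last exact: AE.
    rewrite -scalerAl -scalerAr scalerA mulVf ?tau_neq0 // scale1r.
    by rewrite mulrA -[p.1 * e n * _]mulrA eEc // mulrA.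
  rewrite exchange_big [RHS]xE; apply: eq_big_seq => z /rin [z1 z2].
  by rewrite -!mulr_suml ql.
- move=> x; rewrite {1}DE => -[r rin xE]; rewrite big_map.
  have -> : \sum_(p <- tower_qb n) E n.+1 (x * (tau^-1 *: (p.1 * e n))) * (e n * p.2)
    = \sum_(p <- tower_qb n) \sum_(z <- r) z.1 * e n * (E n (z.2 * p.1) * p.2).
    apply: eq_big_seq => p /qin [p1 p2]; have Dp1 := AD _ p1; have Dp2 := AD _ p2.
    rewrite {1}xE mulr_suml cexpS; last first.
      move=> z /rin [z1 z2]; have Dz1 := AD _ z1; have Dz2 := AD _ z2.
      by rewrite -scalerAr; apply: (subZ (tower_alg n.+2)); repeat first [assumption|apply: (DM)].
    rewrite mulr_suml; apply: eq_big_seq => z /rin [z1 z2].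
    have Azp := AM _ _ z2 p1.
    have -> : z.1 * e n * z.2 * (tau^-1 *: (p.1 * e n)) = tau^-1 *: (z.1 * E n (z.2 * p.1) * e n * 1).
      rewrite -scalerAr mulr1 -[z.1 * _ * e n in RHS]mulrA -eE // !mulrA //.
    rewrite cexpZ'; last first.
      by have Dz1 := AD _ z1; have DEz := AD _ (AE _ Azp); repeat first [assumption|apply: (DM)|exact: (subalg1 (tower_alg n.+2))].
    rewrite dual ?mulr1; [|by apply: AM => //; apply: AE|exact: (subalg1 (tower_alg n.+1))].
    rewrite scalerA mulVf ?tau_neq0 // scale1r.
    by rewrite mulrA -[z.1 * _ * e n]mulrA -eEc // !mulrA.
  rewrite exchange_big [RHS]xE; apply: eq_big_seq => z /rin [z1 z2].
  by rewrite -mulr_sumr qr.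
Qed.

Hypothesis idxs : \sum_(l <- s) l * star l = (jt_index T)%:C *: 1.

Lemma jones_index_tower :
  index_tower N E (fun n => e n) tau tower_qb.
Proof.
have BJ n := let: And3 qin ql qr := tower_qbP n in
  basic_jones (tower_alg n.+1) (tower_alg n) (tower_alg n.+2)
   (tower_sub (n := n)) (tower_exp n) qin ql qr (tower_basic n).
split.
- exact: tower_alg.
- exact: tower_sub.
- exact: tower_exp.
- by move=> n; have [] := tower_basic n.
- by move=> n; have [] := BJ n.
- by move=> n; have [] := BJ n.
- by move=> n x y; apply: jt_dual.
- by move=> n d; have [_ _ -> _] := tower_basic n.
- by move=> n; have [] := tower_qbP n.
- by move=> n; have [] := tower_qbP n.
- by move=> n; have [] := tower_qbP n.
- by move=> n; have [] := BJ n.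
- by [].
- move=> y By; rewrite big_map.
  rewrite (minimal_index (tower_alg 1) (tower_alg 0) (@jt_simpleA R M T) (@jt_simpleB R M T)
    (tower_exp 0) qbs idxs) //; last by have [] := jt_minimal T.
  by rewrite scalerA -rmorphM mulVf ?scale1r // gt_eqF // jt_index_gt0.
- by move=> x; apply: (simple_center (tower_alg 0)); exact: jt_simpleB.
- by move=> x; apply: (simple_center (tower_alg 1)); exact: jt_simpleA.
- exact: tau_neq0.
- by apply: conj_Creal; rewrite complex_real.
Qed.

End QuasiBasis.

(** * Comparison with the normalised operators *)

Section Reflections.
Variable s : seq M.
Hypothesis qbs : quasi_basis (N 1%N) (E 0%N) s.
Hypothesis idxs : \sum_(l <- s) l * star l = (jt_index T)%:C *: 1.

Let H := jones_index_tower qbs idxs.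
Local Notation eT := (fun n => e n).
Local Notation qT := (tower_qb s).
Local Notation PhiT := (Phi E).
Local Notation thetaT := (theta tau qT).

Variable G : nat -> M -> M.
Hypothesis hG : forall m, tr_cond_exp T m (G m).

Lemma trE m x : tr T m x = PhiT 0 m.+1 x.
Proof. by elim: m x => [|m ih] x //; rewrite PhiS -ih. Qed.

Lemma vtowerE m : vtower T m = dn eT 0 m.
Proof. by elim: m => [//|m ih] /=; rewrite ih. Qed.

(** [G m] and [theta] are both modular over the relative commutant of [A] and preserve the trace, so
    their difference [d] satisfies [Phi (d * star d) = 0]. *)
Lemma tr_cond_expE m x : relcomm (N 0%N) (N m.+1) x -> G m x = thetaT 0 x.
Proof.
move=> Bx; have [Gexp Gtr] := hG m.
have BG : relcomm (N 1%N) (N m.+1) (G m x) by exact: (cexp_in Gexp).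
have Bt : relcomm (N 1%N) (N m.+1) (thetaT 0 x) by apply: (theta_box H).
have BD := boxB H BG Bt; set d := G m x - thetaT 0 x in BD *.
have tr_theta y : relcomm (N 0%N) (N m.+1) y ->
    PhiT 0 m.+1 (thetaT 0 y) = PhiT 0 m.+1 y by exact: (Phi_theta H (s := 0) (j := 0)).
have Bz := box_star H BD; set z := star d in Bz *.
have Bxz : relcomm (N 0%N) (N m.+1) (x * z).
  by apply: (boxM H) => //; apply: (box_anti H _ Bz).
have e1 : PhiT 0 m.+1 (G m x * z) = PhiT 0 m.+1 (x * z).
  rewrite -!trE -(Gtr (x * z)) //; congr (tr T m _).
  rewrite -[x in RHS]mul1r (cexpM Gexp) ?mul1r //; exact: (box1 H 1 m.+1).
have e2 : PhiT 0 m.+1 (thetaT 0 x * z) = PhiT 0 m.+1 (x * z).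
  rewrite -[RHS]tr_theta //; apply: (congr1 (PhiT 0 m.+1)).
  rewrite /theta -scalerAl mulr_suml; congr (_ *: _).
  apply: eq_big_seq => p pq; have [_ cz] := Bz.
  by rewrite -!mulrA cz //; have [_] := itw_qb_in H pq.
have [Nd _] := BD; have [Nz _] := Bz; have [NG _] := BG; have [Nt _] := Bt.
apply/eqP; rewrite -subr_eq0; apply/eqP; rewrite -/d -[LHS]starK -/z.
suff -> : z = 0 by rewrite star0.
apply: (Phi_faithful H (s := 0) (k := m.+1)) => //.
rewrite /z starK -/z /d mulrBl (PhiB H) ?e1 ?e2 ?subrr //; exact: (NM H).
Qed.

(** A rotation uses one Fourier transform and one inverse, so the half-integral powers of [tau]
    occur only in pairs. *)
Lemma fourier_cstE n : fourier_cst T n ^+ 2 = tau ^- n.+2.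
Proof.
rewrite /fourier_cst -rmorphXn -exprVn -fmorphV -rmorphXn; congr _%:C.
have t0 : 0 < (jt_index T)^-1 by rewrite invr_gt0 jt_index_gt0.
rewrite -powR_mulrn ?powR_ge0 // -powRrM mulNr divfK ?pnatr_eq0 //.
by rewrite powRN powR_mulrn ?exprVn // ltW.
Qed.

Lemma fourierE n x : relcomm (N 0%N) (N n.+1) x ->
  fourier T G n x = (fourier_cst T n * tau ^+ n.+1) *: Fr eT tau qT n.+1 0 x.
Proof.
move=> Bx; rewrite /fourier vtowerE tr_cond_expE; last exact: (box_dn H).
rewrite /Fr [RHS]scalerA -mulrA mulfV ?mulr1 // expf_neq0 //; exact: tau_neq0.
Qed.

Lemma fourier_invE n w :
  fourier_inv T n w = (fourier_cst T n * tau) *: Fi E eT tau n.+1 0 w.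
Proof.
rewrite /fourier_inv vtowerE (star_dn H) /Fi scalerA -mulrA mulfV ?mulr1 //.
exact: tau_neq0.
Qed.

Let cst_real n : Num.conj (fourier_cst T n) = fourier_cst T n.
Proof. by apply: conj_Creal; rewrite complex_real. Qed.

Let tau_real : Num.conj tau = tau.
Proof. exact: itw_tauC H. Qed.

Let cst_cancel n : (fourier_cst T n * tau ^+ n.+1) * (fourier_cst T n * tau) = 1.
Proof.
rewrite mulrACA -expr2 -exprSr fourier_cstE mulVf // expf_neq0 //.
exact: tau_neq0.
Qed.

Let conj1 n : Num.conj (fourier_cst T n * tau ^+ n.+1) = fourier_cst T n * tau ^+ n.+1.
Proof. by rewrite rmorphM rmorphXn /= cst_real tau_real. Qed.

Let conj2 n : Num.conj (fourier_cst T n * tau) = fourier_cst T n * tau.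
Proof. by rewrite rmorphM /= cst_real tau_real. Qed.

Lemma rho_plusE n x : relcomm (N 0%N) (N n.+1) x ->
  rho_plus T G n x = rho E eT tau qT n.+1 0 x.
Proof.
move=> Bx; have kE : n.+1 = n.+1 by []; have BF := Fr_box H kE Bx.
have [NF _] := BF; have e1 : star (fourier T G n x)
    = (fourier_cst T n * tau ^+ n.+1) *: star (Fr eT tau qT n.+1 0 x).
  by rewrite fourierE // starZ conj1.
rewrite /rho_plus e1 fourier_invE /rho /Kr; set w := Fr eT tau qT n.+1 0 x in NF *.
have -> : Fi E eT tau n.+1 0 ((fourier_cst T n * tau ^+ n.+1) *: star w)
   = (fourier_cst T n * tau ^+ n.+1) *: Fi E eT tau n.+1 0 (star w).
  rewrite /Fi -scalerAl (E_Z H) ?scalerA 1?[tau^-1 * _]mulrC //.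
  by apply: (NM H); [apply: (Nstar H)|apply: (Nup H); lia].
by rewrite scalerA mulrC cst_cancel scale1r.
Qed.

Lemma rho_minusE n w : relcomm (N 1%N) (N n.+2) w ->
  rho_minus T G n w = rhom E eT tau qT n.+1 0 w.
Proof.
move=> Bw; have kE : n.+1 = n.+1 by []; have BF := Fi_box H kE Bw.
have BsF := box_star H BF.
have e1 : star (fourier_inv T n w) = (fourier_cst T n * tau) *: star (Fi E eT tau n.+1 0 w).
  by rewrite fourier_invE starZ conj2.
rewrite /rho_minus e1 fourierE; last exact: (boxZ H).
rewrite /rhom /Lr; set x := star (Fi E eT tau n.+1 0 w) in BsF *.
have -> : Fr eT tau qT n.+1 0 ((fourier_cst T n * tau) *: x)
   = (fourier_cst T n * tau) *: Fr eT tau qT n.+1 0 x.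
  rewrite /Fr /theta -scalerAl.
  have -> : \sum_(p <- qT 0) p.1 * ((fourier_cst T n * tau) *: (x * dn eT 0 n.+1)) * p.2
     = (fourier_cst T n * tau) *: \sum_(p <- qT 0) p.1 * (x * dn eT 0 n.+1) * p.2.
    by rewrite scaler_sumr; apply: eq_bigr => p _; rewrite -scalerAr -scalerAl.
  move: (\sum_(p <- _) _) => y; rewrite !scalerA.
  by rewrite [X in X *: _ = _]mulrA [X in X *: _ = _]mulrC [X in X *: _ = _]mulrA.
by rewrite scalerA cst_cancel scale1r.
Qed.

Lemma r_plusE n x : relcomm (N 0%N) (N (0 + (n.+1 + n.+1))) x ->
  r_plus T G n x = iter n.+1 (rho E eT tau qT (n.+1 + n.+1) 0) x.
Proof.
have kE : (n.+1 + n.+1 = n.*2.+2)%N by rewrite addnn doubleS.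
rewrite /r_plus kE => Bx; elim: n.+1 => [//|m ih]; rewrite !iterS ih rho_plusE //.
exact: (iter_rho_box H (erefl n.*2.+2)).
Qed.

Lemma r_minusE n w : relcomm (N 1%N) (N (1 + (n.+1 + n.+1))) w ->
  r_minus T G n w = iter n.+1 (rho E eT tau qT (n.+1 + n.+1) 1) w.
Proof.
have kE : (n.+1 + n.+1 = n.*2.+2)%N by rewrite addnn doubleS.
move=> Bw; rewrite -(half_turn_rhom H) //; move: Bw; rewrite /r_minus kE => Bw.
suff h m : iter m (rho_minus T G n.*2.+1) w = iter m (rhom E eT tau qT n.*2.+2 0) w /\
    relcomm (N 1%N) (N n.*2.+3) (iter m (rhom E eT tau qT n.*2.+2 0) w).
  by have [] := h n.+1.
elim: m => [//|m [ih1 ih2]]; rewrite !iterS ih1 rho_minusE //; split=> //.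
exact: (Lr_box H (erefl n.*2.+2)) (Fi_box H (erefl n.*2.+2) ih2).
Qed.

Lemma reflection_ext j m (t t' r r' : M -> M) :
  reflection_on (relcomm (N j) (N m)) t r ->
  (forall x, relcomm (N j) (N m) x -> r' x = r x) ->
  (forall x y, relcomm (N j) (N m) x -> relcomm (N j) (N m) y ->
     t x = t y -> t' x = t' y) ->
  reflection_on (relcomm (N j) (N m)) t' r'.
Proof.
move=> refl rE tE; have Sr x Sx := refl_in refl (x := x) Sx.
split.
- by move=> x Sx; rewrite rE //; apply: Sr.
- move=> a x y Sx Sy; rewrite !rE //; first exact: (refl_linear refl).
  by apply: (boxD H) => //; apply: (boxZ H).
- move=> x y Sx Sy; rewrite !rE //; first exact: (refl_antiM refl).
  exact: (boxM H).
- by rewrite rE; [exact: (refl1 refl)|exact: (box1 H)].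
- by move=> x Sx; rewrite !rE //; [exact: (reflK refl)|exact: Sr].
- move=> x Sx; rewrite !rE //; first exact: (refl_star refl).
  exact: (box_star H).
- move=> x Sx; rewrite rE //; apply: tE => //; first exact: Sr.
  exact: (refl_tr refl).
Qed.

Lemma reflections n :
  reflection_on (BcommA T n.*2.+1) (tr T n.*2.+1) (r_plus T G n) /\
  reflection_on (AcommA T n.*2.+2) (tr T n.*2.+2) (r_minus T G n).
Proof.
(* With [p = n + 1], A_(2n+1) is [N (p + p)] and A_(2n+2) is [N (1 + (p + p))], as [N] starts at
   [B]. *)
have kE : (n.+1 + n.+1 = n.*2.+2)%N by rewrite addnn doubleS.
split.
  have refl := half_turn_reflection H 0 (ltn0Sn n).
  have rE := @r_plusE n; rewrite kE in refl rE.
  apply: (reflection_ext refl rE) => x y _ _; by rewrite !trE.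
have refl := half_turn_reflection H 1 (ltn0Sn n).
have rE := @r_minusE n; rewrite kE in refl rE.
(* The half turn of the tower from [N 1] preserves [Phi] down to [N 1]; a further [E 0] gives the
   trace. *)
by apply: (reflection_ext refl rE) => x y _ _; rewrite !trE !Phi_catS => ->.
Qed.

End Reflections.
End JonesTower.

Theorem theoremA (R : realType) (M : cstarType R) (T : jonesTower M)
    (G : nat -> M -> M) (hG : forall m : nat, tr_cond_exp T m (G m)) (n : nat) :
  reflection_on (BcommA T n.*2.+1) (tr T n.*2.+1) (r_plus T G n) /\
  reflection_on (AcommA T n.*2.+2) (tr T n.*2.+2) (r_minus T G n).
Proof.
have [[_ [s qbs idxs]] _] := jt_minimal T.
exact: (reflections qbs idxs hG).
Qed.
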